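(* Let $G(V,E)$ be a connected trivalent graph and $\Gamma$ a ribbon graph of it. Let $n\in\mathbb{N}$ and let $\mathbb{k}$ be a ring in which $\sqrt n$ is defined. There exists a spectral sequence that has the form $$E_1^{i,j}=VCH_n^{i,j}(\Gamma;\mathbb{k})\ \Longrightarrow\ \widehat{VCH}_n^i(\Gamma;\mathbb{k})$$ when expressed in terms of the gradings of $C_n^{i,j}(\Gamma)$ ($i$ homological, $j$ quantum). Thus, the $E_\infty$-page of this spectral sequence is isomorphic to $\widehat{VCH}_n^*(\Gamma;\mathbb{k})$.
   Context: Graphs are finite multigraphs: loops and multiple edges are allowed, and so are ''vertex-less'' edges (circles, also regarded as loops). Trivalent means every vertex has degree 3 (a loop at a vertex counts twice). Ribbon graphs. A ribbon graph $\Gamma$ of $G$ is a surface with boundary in which $G$ is embedded and which deformation retracts onto $G$; combinatorially, a disc for each vertex and a band for each edge, with a cyclic order of half-edges at each vertex and possibly half-twisted bands (a vertex-less edge gives an annulus or Möbius band). States. Let $H$ be the set of half-edges (pairs of an edge and one of its ends at a vertex). For $\alpha\in\{0,1\}^H$, $\Gamma_\alpha$ is obtained from $\Gamma$ by inserting, for each $h$ with $\alpha_h=1$, one half-twist in the band of the edge containing $h$. For $\nu\in\{0,1\}^V$ let $\alpha(\nu)_h=\nu_v$ where $v$ is the vertex of $h$. $|\nu|=\sum_v\nu_v$, $|\alpha|=\sum_h\alpha_h$. Circles of a state are its boundary circles. Bigraded homology. Let $m=n/2$ if $n$ is even, $m=(n-1)/2$ if $n$ is odd. Let $A=\mathbb{k}[x]/(x^n)$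 with basis $1,x,\dots,x^{n-1}$, $\deg x^k=m-k$, and maps $\mu(x^i\otimes x^j)=x^{i+j}$ if $i+j<n$, else $0$; $\Delta(x^k)=\sum_{0\le i,j<n,\ i+j=k+2m}x^i\otimes x^j$; $\eta(x^k)=\sqrt n\,x^{k+m}$ if $k+m<n$, else $0$. Put $A_\alpha=A^{\otimes(\text{circles of }\Gamma_\alpha)}$ with degrees shifted up by $m|\alpha|$. If $\alpha'$ is obtained from $\alpha$ by changing one coordinate from 0 to 1, the half-twist merges two circles, splits one circle into two, or changes one circle to one circle; $\partial_{\alpha\alpha'}$ applies $\mu,\Delta,\eta$ respectively on affected factors and the identity elsewhere. If $\nu'$ is obtained from $\nu$ by changing one coordinate from 0 to 1, $\delta_{\nu\nu'}$ is the composition of three maps $\partial$ along any 3-step path from $\alpha(\nu)$ to $\alpha(\nu')$ (independent of the path). Ordering $V$, let $C_n^{i,j}(\Gamma)$ be the degree $j$ part of $\bigoplus_{|\nu|=i}A_{\alpha(\nu)}$ and $\delta=\sum_{\nu'}(-1)^s\delta_{\nu\nu'}$ on the $\nu$-summand, with $s$ the number of 1's of $\nu$ before the changed coordinate. $VCH_n^{i,j}(\Gamma;\mathbb{k})$ is the homology of $(C_n^{*,j}(\Gamma),\delta)$ at $i$. Filtered homology. On the same underlying module, use instead the algebra $\widehat A=\mathbb{k}[x]/(x^n-1)$, with $\widehat\mu$ its multiplication, $\widehat\Delta(x^k)=\sum_{0\le i,j<n,\ i+j\equiv k+2m\ (n)}x^i\otimes x^j$, $\widehat\eta(x^k)=\sqrt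 n\,x^{k+m}$ (exponent mod $n$). Repeating the construction with $\widehat\mu,\widehat\Delta,\widehat\eta$ in place of $\mu,\Delta,\eta$ gives a differential $\widehat\delta$ on $\widehat C_n^i(\Gamma)=\bigoplus_j C_n^{i,j}(\Gamma)$; $\widehat{VCH}_n^i(\Gamma;\mathbb{k})$ is the homology of $(\widehat C_n^*(\Gamma),\widehat\delta)$ at $i$. The spectral sequence is the one induced by the finite decreasing filtration $\mathcal F^p\widehat C_n^*(\Gamma)=\bigoplus_{j\ge p}C_n^{*,j}(\Gamma)$, which $\widehat\delta$ preserves. *)

(* Defs.v *)
From HB Require Import structures.
From mathcomp Require Import all_boot all_order all_fingroup all_algebra.
From mathcomp Require Import generic_quotient ring_quotient.
From mathcomp Require Import boolp.

Set Implicit Arguments.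
Unset Strict Implicit.
Unset Printing Implicit Defensive.

Import GRing.Theory.
Local Open Scope ring_scope.
Local Open Scope quotient_scope.

Section Submodules.
Variable k : pzRingType.

Section Ops.
Variables (U V : lmodType k) (f : {linear U -> V}).

Definition sm_full : {pred U} := predT.
Definition sm_ker : {pred U} := [pred x | f x == 0].
Definition sm_preim (B : submodClosed V) : {pred U} := [pred x | f x \in B].
Definition sm_im (Z : submodClosed U) : {pred V} :=
  [pred y | `[< exists2 x, x \in Z & y = f x >] ].
Definition sm_cap (Z B : submodClosed U) : {pred U} :=
  [pred x | (x \in Z) && (x \in B)].
Definition sm_add (Z B : submodClosed U) : {pred U} :=
  [pred x | `[< exists y z, [/\ y \in Z, z \in B & x = y + z] >] ].

Lemma sm_full_closed : submod_closed sm_full.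
Proof. by []. Qed.

Lemma sm_ker_closed : submod_closed sm_ker.
Proof.
split=> [|a x y]; rewrite !inE ?linear0 // => /eqP fx /eqP fy.
by rewrite linearP fx fy scaler0 addr0.
Qed.

Lemma sm_preim_closed B : submod_closed (sm_preim B).
Proof.
split=> [|a x y]; rewrite !inE ?linear0 ?rpred0 // => fx fy.
by rewrite linearP rpredD ?rpredZ.
Qed.

Lemma sm_im_closed Z : submod_closed (sm_im Z).
Proof.
split=> [|a _ _ /asboolP[x xZ ->] /asboolP[y yZ ->]]; apply/asboolP.
  by exists 0; rewrite ?rpred0 ?linear0.
by exists (a *: x + y); rewrite ?linearP ?rpredD ?rpredZ.
Qed.

Lemma sm_cap_closed Z B : submod_closed (sm_cap Z B).
Proof.
split=> [|a x y]; rewrite !inE ?rpred0 // => /andP[? ?] /andP[? ?].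
by rewrite !rpredD ?rpredZ.
Qed.

Lemma sm_add_closed Z B : submod_closed (sm_add Z B).
Proof.
split=> [|a _ _ /asboolP[x [y [xZ yB ->]]] /asboolP[z [t [zZ tB ->]]]];
  apply/asboolP.
  by exists 0, 0; rewrite !rpred0 addr0.
by exists (a *: x + z), (a *: y + t); rewrite !rpredD ?rpredZ // scalerDr addrACA.
Qed.

HB.instance Definition _ :=
  GRing.isSubmodClosed.Build k U sm_full sm_full_closed.
HB.instance Definition _ := GRing.isSubmodClosed.Build k U sm_ker sm_ker_closed.
HB.instance Definition _ B :=
  GRing.isSubmodClosed.Build k U (sm_preim B) (sm_preim_closed B).
HB.instance Definition _ Z :=
  GRing.isSubmodClosed.Build k V (sm_im Z) (sm_im_closed Z).
HB.instance Definition _ Z B :=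
  GRing.isSubmodClosed.Build k U (sm_cap Z B) (sm_cap_closed Z B).
HB.instance Definition _ Z B :=
  GRing.isSubmodClosed.Build k U (sm_add Z B) (sm_add_closed Z B).
End Ops.

Section Quotient.
Variables (V : lmodType k) (B : submodClosed V).

Definition sm_zmod : {pred V} := [pred x | x \in B].
Lemma sm_zmod_closed : zmod_closed sm_zmod.
Proof. exact: submodClosedP B. Qed.
HB.instance Definition _ := GRing.isZmodClosed.Build V sm_zmod sm_zmod_closed.

Definition quotm := Quotient.quot sm_zmod.
HB.instance Definition _ := GRing.Zmodule.on quotm.
HB.instance Definition _ := EqQuotient.on quotm.

Definition quotm_scale (a : k) (q : quotm) : quotm := \pi_quotm (a *: repr q).

Lemma pi_quotm_scale a x : quotm_scale a (\pi_quotm x) = \pi_quotm (a *: x).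
Proof.
apply/eqP; rewrite /quotm_scale -(Quotient.idealrBE sm_zmod) -scalerBr.
rewrite [_ \in _](_ : (_ \in B) = true) // rpredZ //.
have := Quotient.idealrBE sm_zmod (repr (\pi_quotm x)) x.
by rewrite reprK eqxx.
Qed.

Lemma pi_quotmD x y : \pi_quotm (x + y) = \pi_quotm x + \pi_quotm y.
Proof. exact: (Quotient.pi_add sm_zmod x y). Qed.

Lemma quotm_ind (P : quotm -> Prop) :
  (forall x, P (\pi_quotm x)) -> forall q, P q.
Proof. by move=> Px q; rewrite -[q]reprK. Qed.

Lemma quotm_scaleA a b q :
  quotm_scale a (quotm_scale b q) = quotm_scale (a * b) q.
Proof. by elim/quotm_ind: q => x; rewrite !pi_quotm_scale scalerA. Qed.
Lemma quotm_scale1 : left_id 1 quotm_scale.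
Proof. by elim/quotm_ind=> x; rewrite pi_quotm_scale scale1r. Qed.
Lemma quotm_scaleDr : right_distributive quotm_scale +%R.
Proof.
move=> a; elim/quotm_ind=> x; elim/quotm_ind=> y.
by rewrite -pi_quotmD !pi_quotm_scale scalerDr pi_quotmD.
Qed.
Lemma quotm_scaleDl q : {morph quotm_scale^~ q : a b / a + b}.
Proof.
by elim/quotm_ind: q => x a b; rewrite !pi_quotm_scale scalerDl pi_quotmD.
Qed.
HB.instance Definition _ := GRing.Zmodule_isLmodule.Build k quotm
  quotm_scaleA quotm_scale1 quotm_scaleDr quotm_scaleDl.
End Quotient.

Section Subquotient.
Variables (V : lmodType k) (Z B : submodClosed V).

Definition subm := {x : V | x \in Z}.
HB.instance Definition _ := SubChoice.on subm.
HB.instance Definition _ := [SubChoice_isSubLmodule of subm by <:].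

Definition sub_val : subm -> V := val.
Lemma sub_val_linear : linear sub_val.
Proof. by move=> a x y; rewrite /sub_val linearP. Qed.
HB.instance Definition _ :=
  GRing.isLinear.Build k subm V *:%R sub_val sub_val_linear.

(* Z / (Z \cap B) *)
Definition subquot := quotm (sm_preim sub_val B).
HB.instance Definition _ := GRing.Lmodule.on subquot.

Definition cls (x : subm) : subquot := \pi_subquot x.
End Subquotient.

Definition lmod_iso (U V : lmodType k) : Prop :=
  exists f : {linear U -> V}, bijective f.

Definition projective (P : lmodType k) : Prop :=
  forall (U : lmodType k) (f : {linear U -> P}),
    (forall y, exists x, f x = y) ->
    exists g : {linear P -> U}, forall y, f (g y) = y.

Definition isom_direct_sum (E : int -> lmodType k) (H : lmodType k) : Prop :=
  exists phi : forall j, {linear E j -> H},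
    (forall h, exists (s : seq int) (e : forall j, E j),
       h = \sum_(j <- s) phi j (e j)) /\
    (forall (s : seq int) (e : forall j, E j), uniq s ->
       \sum_(j <- s) phi j (e j) = 0 -> forall j, j \in s -> e j = 0).

End Submodules.

Arguments cls {k V Z B} x.
Arguments lmod_iso {k} U V.

Definition is_field (k : comPzRingType) : Prop :=
  (1 : k) != 0 /\ forall x : k, x != 0 -> exists y, x * y = 1.

(* Cohomological spectral sequences starting at page 1, in the indexing by
   (homological degree i, filtration degree j), in which d_r has bidegree
   (1, r).  The components of d_r between arbitrary bidegrees are given and the
   others are required to vanish: this avoids casts along equalities such as
   i - 1 + 1 = i.  Nothing is required of page 0. *)
Section SpectralSequences.
Variable k : pzRingType.

Record spectral_sequence := SpectralSequence {
  page : nat -> int -> int -> lmodType k;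
  dif : forall r i j i' j', {linear page r i j -> page r i' j'};
  dif_bidegree : forall r i j i' j', (0 < r)%N ->
    (i', j') <> (i + 1, j + r%:Z) -> forall x, dif r i j i' j' x = 0;
  dif_dif : forall r i j i' j' i'' j'', (0 < r)%N ->
    forall x, dif r i' j' i'' j'' (dif r i j i' j' x) = 0;
  turn : forall r i j,
    {linear subquot (sm_ker (dif r i j (i + 1) (j + r%:Z)))
                    (sm_im (dif r (i - 1) (j - r%:Z) i j) (@sm_full _ _))
     -> page r.+1 i j};
  turn_bij : forall r i j, (0 < r)%N -> bijective (@turn r i j)
}.

(* Einf is the limit page: in each bidegree the differentials vanish from
   some page on, so that the later pages are all isomorphic. *)
Definition is_infinity_page (E : spectral_sequence)
    (Einf : int -> int -> lmodType k) : Prop :=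
  forall i j, exists2 r0, (0 < r0)%N & forall r, (r0 <= r)%N ->
    [/\ forall i' j' x, dif E r i j i' j' x = 0,
        forall i' j' x, dif E r i' j' i j x = 0
      & lmod_iso (page E r i j) (Einf i j)].

(* Einf is the associated graded of the modules H i for the decreasing
   filtrations Fil i, which are required to be finite. *)
Definition abuts (Einf : int -> int -> lmodType k) (H : int -> lmodType k)
    (Fil : forall i, int -> submodClosed (H i)) : Prop :=
  [/\ forall i p, {subset Fil i (p + 1) <= Fil i p},
      forall i, exists p, forall h, h \in Fil i p,
      forall i, exists p, forall h, h \in Fil i p -> h = 0
    & forall i j, lmod_iso (Einf i j) (subquot (Fil i j) (Fil i (j + 1)))].

Section Filtered.
(* The complex is the family of submodules C i of a single module M, with
   differential the restriction of d, and F p i is the p-th step of the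
   filtration of C i. *)
Variables (M : lmodType k) (d : {linear M -> M}).
Variables (C : int -> submodClosed M) (F : int -> int -> submodClosed M).

Definition cycles i := sm_cap (C i) (sm_ker d).
Definition boundaries i := sm_im d (C (i - 1)).
HB.instance Definition _ i := GRing.SubmodClosed.on (cycles i).
HB.instance Definition _ i := GRing.SubmodClosed.on (boundaries i).

Definition homology i : lmodType k := subquot (cycles i) (boundaries i).

Definition homology_class i (x : subm (cycles i)) : homology i := cls x.
Lemma homology_class_linear i : linear (@homology_class i).
Proof.
by move=> a x y; rewrite /homology_class /cls pi_quotmD -pi_quotm_scale.
Qed.
HB.instance Definition _ i :=
  GRing.isLinear.Build k _ _ *:%R (@homology_class i)
    (@homology_class_linear i).

(* the image of the homology of F p in that of C *)
Definition homology_filtration i p : submodClosed (homology i) :=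
  sm_im (@homology_class i) (sm_preim (@sub_val k M (cycles i)) (F p i)).

(* Z_r^{i,j} = {x in F^j C^i | d x in F^(j+r) C^(i+1)} and, for r > 0,
   B_r^{i,j} = Z_(r-1)^{i,j+1} + d Z_(r-1)^{i-1,j-r+1} *)
Definition Zr (r : nat) i j : submodClosed M :=
  sm_cap (F j i) (sm_preim d (F (j + r%:Z) (i + 1))).
Definition Br (r : nat) i j : submodClosed M :=
  sm_add (Zr r.-1 i (j + 1)) (sm_im d (Zr r.-1 (i - 1) (j - r%:Z + 1))).

Definition induced_by_filtration (E : spectral_sequence) : Prop :=
  exists phi : forall r i j,
      {linear subquot (Zr r i j) (Br r i j) -> page E r i j},
  [/\ forall r i j, (0 < r)%N -> bijective (phi r i j),
      forall r i j (z : subm (Zr r i j))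
             (z' : subm (Zr r (i + 1) (j + r%:Z))), (0 < r)%N ->
        val z' = d (val z) ->
        dif E r i j (i + 1) (j + r%:Z) (phi r i j (cls z)) =
          phi r (i + 1) (j + r%:Z) (cls z')
    & forall r i j (z : subm (Zr r i j)) (w : subm (Zr r.+1 i j))
             (x : subm (sm_ker (dif E r i j (i + 1) (j + r%:Z)))), (0 < r)%N ->
        val w = val z -> val x = phi r i j (cls z) ->
        turn E r i j (cls x) = phi r.+1 i j (cls w)].

End Filtered.
End SpectralSequences.

(* An edge with vertices is an orbit {h, opp h} of half-edges; [circ] is the
   set of vertex-less edges. *)
Record graph := Graph {
  vertex : finType;
  hedge : finType;
  circ : finType;
  endpt : hedge -> vertex;
  opp : hedge -> hedge;
  oppK : involutive opp;
  opp_neq : forall h, opp h != h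
}.

Definition trivalent (G : graph) : Prop :=
  forall v : vertex G, #|[set h : hedge G | endpt h == v]| = 3.

(* A vertex-less edge is a connected component by itself. *)
Definition adjacent (G : graph) : rel (vertex G + circ G) :=
  fun x y => match x, y with
  | inl v, inl w => [exists h : hedge G, (endpt h == v) && (endpt (opp h) == w)]
  | _, _ => false
  end.

Definition connected (G : graph) : Prop :=
  exists x : vertex G + circ G, forall y, connect (@adjacent G) x y.

(* The cycles of [rot] are the cyclic orders of the half-edges at the vertices;
   [twist] and [ctwist] tell which bands are half-twisted. *)
Record ribbon (G : graph) := Ribbon {
  rot : {perm hedge G};
  rotP : forall h h', (h' \in porbit rot h) = (endpt h' == endpt h);
  twist : hedge G -> bool;
  twist_opp : forall h, twist (opp h) = twist h;
  ctwist : circ G -> bool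
}.

Section States.
Variables (G : graph) (Gam : ribbon G).

(* A band is attached to the disc of a vertex along an arc, and (h, false) and
   (h, true) are the first and last points of that arc for the cyclic order at
   the vertex; (c, false) and (c, true) stand for the sides of the band of a
   vertex-less edge c. *)
Definition bpoint : finType := ((hedge G * bool) + (circ G * bool))%type.

(* States alpha in {0,1}^H are encoded as sets of half-edges. *)
Definition band_twist (alpha : {set hedge G}) (h : hedge G) : bool :=
  twist Gam h (+) (h \in alpha) (+) (opp h \in alpha).

(* p and q are joined by an arc of the boundary of Gamma_alpha: an arc of the
   boundary of a vertex disc, or a side of a band. *)
Definition boundary_arc (alpha : {set hedge G}) : rel bpoint := fun p q =>
  match p, q with
  | inl (h, b), inl (h', b') =>
      [|| [&& b, ~~ b' & h' == rot Gam h],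
          [&& ~~ b, b' & h == rot Gam h']
        | (h' == opp h) && (b' == b (+) ~~ band_twist alpha h)]
  | inr (c, b), inr (c', b') => [&& c' == c, b' != b & ctwist Gam c]
  | _, _ => false
  end.

(* The circles of Gamma_alpha are the classes of [same_circle alpha].  (A vertex
   of degree 0 would contribute one more circle: this encoding is for graphs
   without isolated vertices.) *)
Definition same_circle (alpha : {set hedge G}) : rel bpoint :=
  connect (boundary_arc alpha).

(* A basis element of the tensor power of A indexed by the circles of
   Gamma_alpha assigns a power of x to each circle; it is encoded as the function
   on boundary points which is constant on circles. *)
Definition mono n := {ffun bpoint -> 'I_n}.

Definition is_state_mono n (alpha : {set hedge G}) (f : mono n) : bool :=
  [forall p, forall q, same_circle alpha p q ==> (f p == f q)].

(* [roots] picks one boundary point on each circle. *)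
Definition state_degree n (alpha : {set hedge G}) (f : mono n) : int :=
  (n./2 * #|alpha|)%:Z +
  \sum_(p | roots (boundary_arc alpha) p) ((n./2)%:Z - (f p : nat)%:Z).

Definition alpha_of (nu : {set vertex G}) : {set hedge G} :=
  [set h | endpt h \in nu].

Variable k : comPzRingType.

(* Matrix entries in the basis of powers of x:
   mu (x^i (x) x^j) = \sum_l c_mu i j l x^l,
   Delta (x^l) = \sum_(i, j) c_Delta l i j x^i (x) x^j,
   eta (x^i) = \sum_l c_eta i l x^l. *)
Record structure n := Structure {
  c_mu : 'I_n -> 'I_n -> 'I_n -> k;
  c_Delta : 'I_n -> 'I_n -> 'I_n -> k;
  c_eta : 'I_n -> 'I_n -> k
}.

Definition bigraded_structure n (sqrtn : k) : structure n := {|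
  c_mu := fun i j l => ((i + j)%N == l)%:R;
  c_Delta := fun l i j => ((i + j)%N == (l + 2 * n./2)%N)%:R;
  c_eta := fun i l => sqrtn *+ ((i + n./2)%N == l)
|}.

Definition filtered_structure n (sqrtn : k) : structure n := {|
  c_mu := fun i j l => (i + j == l %[mod n])%N%:R;
  c_Delta := fun l i j => (i + j == l + 2 * n./2 %[mod n])%N%:R;
  c_eta := fun i l => sqrtn *+ (i + n./2 == l %[mod n])%N
|}.

Variables (n : nat) (T : structure n).

Definition tensors := {ffun mono n -> k^o}.

(* Matrix entry of the map from alpha to alpha + h.  Every affected circle
   passes through one of the two points of h. *)
Definition edge_coef (alpha : {set hedge G}) (h : hedge G) (f g : mono n) : k :=
  let p : bpoint := inl (h, false) in
  let q : bpoint := inl (h, true) in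
  let alpha' := h |: alpha in
  if [&& is_state_mono alpha f, is_state_mono alpha' g
       & [forall x, ~~ same_circle alpha p x && ~~ same_circle alpha q x
                    ==> (g x == f x)]]
  then if ~~ same_circle alpha p q then c_mu T (f p) (f q) (g p)
       else if ~~ same_circle alpha' p q then c_Delta T (f p) (g p) (g q)
       else c_eta T (f p) (g p)
  else 0.

Definition edge_map alpha h (u : tensors) : tensors :=
  [ffun g => \sum_f edge_coef alpha h f g *: u f].

Fixpoint path_map alpha (s : seq (hedge G)) (u : tensors) : tensors :=
  if s is h :: s' then path_map (h |: alpha) s' (edge_map alpha h u) else u.

(* The choices made in the definition of delta: an ordering of the vertices, and
   for each edge nu -> nu + v of the cube a path from alpha(nu) to
   alpha(nu + v). *)
Record choices := Choices {
  vorder : vertex G -> nat;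
  vorder_inj : injective vorder;
  steps : {set vertex G} -> vertex G -> seq (hedge G);
  stepsP : forall nu v, perm_eq (steps nu v) (enum [set h | endpt h == v])
}.

Variable ch : choices.

(* States nu in {0,1}^V are encoded as sets of vertices. *)
Definition sign_exponent (nu : {set vertex G}) (v : vertex G) : nat :=
  #|[set w in nu | (vorder ch w < vorder ch v)%N]|.

Definition chains := {ffun {set vertex G} -> tensors}.

Definition delta (c : chains) : chains :=
  [ffun nu' : {set vertex G} => \sum_(v in nu')
     let nu := nu' :\ v in
     (-1) ^+ sign_exponent nu v *:
       path_map (alpha_of nu) (steps ch nu v) (c nu)].

Lemma edge_map_linear alpha h : linear (edge_map alpha h).
Proof.
move=> a u v; apply/ffunP=> g; rewrite !ffunE scaler_sumr -big_split /=.
apply: eq_bigr => f _; rewrite !ffunE scalerDr !scalerA.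
by congr (_ *: _ + _); rewrite mulrC.
Qed.

Lemma path_map_linear alpha s : linear (path_map alpha s).
Proof.
elim: s alpha => [|h s IHs] alpha a u v //=.
by rewrite edge_map_linear IHs.
Qed.

Lemma delta_linear : linear delta.
Proof.
move=> a c c'; apply/ffunP=> nu; rewrite !ffunE scaler_sumr -big_split /=.
apply: eq_bigr => v _; rewrite !ffunE path_map_linear scalerDr !scalerA.
by congr (_ *: _ + _); rewrite mulrC.
Qed.

HB.instance Definition _ := GRing.isLinear.Build k chains chains *:%R delta
  delta_linear.

Definition supported (P : {set vertex G} -> mono n -> bool) : {pred chains} :=
  [pred c : chains |
     [forall nu : {set vertex G}, forall f, (c nu f != 0) ==> P nu f]].

Lemma supported_closed P : submod_closed (supported P).
Proof.
split=> [|a c c' /forallP Pc /forallP Pc']; apply/forallP=> nu; apply/forallP=> f.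
  by rewrite !ffunE eqxx.
move: (forallP (Pc nu) f) (forallP (Pc' nu) f); rewrite !ffunE.
case: (P nu f) => //; first by rewrite !implybT.
by rewrite !implybF !negbK => /eqP -> /eqP ->; rewrite scaler0 addr0 eqxx.
Qed.

HB.instance Definition _ P := GRing.isSubmodClosed.Build k chains (supported P)
  (supported_closed P).

Definition chain_basis (i : int) (nu : {set vertex G}) (f : mono n) : bool :=
  (#|nu|%:Z == i) && is_state_mono (alpha_of nu) f.

Definition Chat (i : int) : submodClosed chains := supported (chain_basis i).

Definition Cij (i j : int) : submodClosed chains := supported (fun nu f =>
  chain_basis i nu f && (state_degree (alpha_of nu) f == j)).

Definition Cfilt (p i : int) : submodClosed chains := supported (fun nu f =>
  chain_basis i nu f && (p <= state_degree (alpha_of nu) f)).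

End States.

Section Homology.
Variables (G : graph) (Gam : ribbon G) (k : comPzRingType).
Variables (n : nat) (sqrtn : k) (ch : choices G).

Definition delta_n : {linear chains G k n -> chains G k n} :=
  delta Gam (bigraded_structure n sqrtn) ch.

Definition delta_hat : {linear chains G k n -> chains G k n} :=
  delta Gam (filtered_structure n sqrtn) ch.

Definition VCH (i j : int) : lmodType k :=
  homology delta_n (fun i' => Cij Gam k n i' j) i.

Definition VCHhat (i : int) : lmodType k :=
  homology delta_hat (Chat Gam k n) i.

Definition VCHhat_filtration (i p : int) : submodClosed (VCHhat i) :=
  homology_filtration delta_hat (Chat Gam k n) (Cfilt Gam k n) i p.
End Homology.

(* Main.v *)
(* The pages of the spectral sequence are the subquotients Z_r / B_r of the
   filtered complex.  Two facts about the cube of states are needed: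
   delta_hat preserves the filtration with delta as its degree preserving
   part, and delta_hat squares to 0.

   For the first, the exponents on both sides of a step agree modulo n, and
   the one of the target, shift included, cannot be the larger: reducing an
   exponent modulo n raises the degree by n.

   For the second, two steps must commute.  Over a field containing a primitive
   n-th root of unity z, the edge maps are diagonal with respect to characters:
   colour the circles by phi with values in {0, ..., n - 1} and weigh a state
   by the product over its circles of z^(phi * exponent) / lam phi, where
   lam a = sqrt n * z^(m * a).  A step at the half-edge h vanishes on this
   character unless phi agrees on the two sides of h, and then multiplies it by
   lam phi; such multiplications commute.  The two-step matrix entries are
   natural numbers times powers of sqrt n, so that their equality for both
   square roots of n in algC implies it over every ring with a square root
   of n. *)
From HB Require Import structures.
From mathcomp Require Import all_boot all_order all_fingroup all_algebra.
From mathcomp Require Import all_field generic_quotient ring_quotient.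
From mathcomp Require Import boolp zify ring.
From mathcomp Require classical_sets.
Require Import Defs.

Set Implicit Arguments.
Unset Strict Implicit.
Unset Printing Implicit Defensive.

Import GRing.Theory Num.Theory.
Local Open Scope ring_scope.

(** * Linear maps between subquotients *)

Section LinearMaps.
Local Open Scope quotient_scope.
Variable k : pzRingType.

Definition linear_of (U V : lmodType k) (f : U -> V) (fL : linear f) :
  {linear U -> V} := HB.pack f (GRing.isLinear.Build k U V *:%R f fL).

(** The chosen preimages [g] under [a] need not form a linear map, but [b \o g] is linear because
    [b w] depends only on [a w]. The differentials and turning maps of the spectral sequence are
    built this way. *)
Lemma linear_factor (W X Y : lmodType k) (a : {linear W -> X})
    (b : {linear W -> Y}) :
  (forall x, exists w, a w = x) -> (forall w, a w = 0 -> b w = 0) ->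
  {t : {linear X -> Y} | forall w, t (a w) = b w}.
Proof.
move=> aS ab0; pose g x := projT1 (cid (aS x)).
have ag x : a (g x) = x by rewrite /g; case: cid.
have bE w w' : a w = a w' -> b w = b w'.
  by move=> aE; apply/eqP; rewrite -subr_eq0 -linearB ab0 // linearB aE subrr.
have tL : linear (b \o g).
  by move=> c x y /=; rewrite -linearP; apply: bE; rewrite linearP !ag.
by exists (linear_of tL) => w; apply: bE; rewrite ag.
Qed.

(** The inverse is the factorization of [a] through [b]. *)
Lemma factor_bij (W X Y : lmodType k) (a : {linear W -> X})
    (b : {linear W -> Y}) (t : {linear X -> Y}) :
    (forall x, exists w, a w = x) -> (forall y, exists w, b w = y) ->
    (forall w, b w = 0 -> a w = 0) -> (forall w, t (a w) = b w) ->
  bijective t.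
Proof.
move=> aS bS ba0 tE; have [s sE] := linear_factor bS ba0.
exists s => [x|y]; first by have [w <-] := aS x; rewrite tE sE.
by have [w <-] := bS y; rewrite sE tE.
Qed.

Lemma lmod_iso_factor (W X Y : lmodType k) (a : {linear W -> X})
    (b : {linear W -> Y}) :
    (forall x, exists w, a w = x) -> (forall y, exists w, b w = y) ->
    (forall w, a w = 0 <-> b w = 0) ->
  lmod_iso X Y.
Proof.
move=> aS bS ab0; have [t tE] := linear_factor aS (fun w => (ab0 w).1).
by exists t; apply: (factor_bij aS bS _ tE) => w /ab0.
Qed.

Definition subm_of (V : lmodType k) (Z : submodClosed V) x (xZ : x \in Z) :
  subm Z := Sub x xZ.

Lemma val_submB (V : lmodType k) (Z : submodClosed V) (x y : subm Z) :
  val (x - y) = val x - val y.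
Proof. exact: (linearB (@sub_val k V Z)). Qed.

Lemma submB (V : lmodType k) (Z : submodClosed V) (x y : V) :
  x \in Z -> y \in Z -> x - y \in Z.
Proof. by move=> xZ yZ; rewrite -scaleN1r rpredD ?rpredZ. Qed.

Lemma submN (V : lmodType k) (Z : submodClosed V) (x : V) :
  x \in Z -> - x \in Z.
Proof. by move=> xZ; rewrite -scaleN1r rpredZ. Qed.

Section Restriction.
Variables (U V : lmodType k) (f : {linear U -> V}).
Variables (Z : submodClosed U) (Z' : submodClosed V).
Hypothesis fZ : forall x, x \in Z -> f x \in Z'.

Definition restr_fun (x : subm Z) : subm Z' := Sub (f (val x)) (fZ (valP x)).
Lemma restr_fun_linear : linear restr_fun.
Proof. move=> a x y; apply: val_inj.
rewrite -[val (restr_fun _)]/(f (sub_val _)) linearP linearP.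
by rewrite [RHS](linearP (@sub_val k V Z')).
Qed.
Definition restr : {linear subm Z -> subm Z'} := linear_of restr_fun_linear.
End Restriction.

Section Classes.
Variables (V : lmodType k) (Z B : submodClosed V).
Lemma cls_linear : linear (@cls k V Z B).
Proof. by move=> a x y; rewrite /cls pi_quotmD -pi_quotm_scale. Qed.
HB.instance Definition _ :=
  GRing.isLinear.Build k (subm Z) (subquot Z B) *:%R (@cls k V Z B) cls_linear.

Lemma cls_surj (q : subquot Z B) : exists x, cls x = q.
Proof. by elim/quotm_ind: q => x; exists x. Qed.

Lemma cls_eq0 (x : subm Z) : cls x = 0 :> subquot Z B <-> val x \in B.
Proof.
have := Quotient.idealrBE (sm_zmod (sm_preim (@sub_val k V Z) B)) x 0.
rewrite subr0 => E; rewrite -[X in X <-> _]/(\pi_(quotm _) x = 0).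
have -> : 0 = \pi_(quotm (sm_preim (@sub_val k V Z) B)) 0.
  by rewrite -[LHS](linear0 (@cls k V Z B)).
by split=> [/eqP|xB]; [rewrite -E | apply/eqP; rewrite -E].
Qed.
Lemma cls_eq (x y : subm Z) :
  cls x = cls y :> subquot Z B <-> val x - val y \in B.
Proof.
rewrite -val_submB -cls_eq0 linearB.
by split=> [E|/eqP]; [apply/eqP|]; rewrite subr_eq0; [apply/eqP | move/eqP].
Qed.
End Classes.
End LinearMaps.

(** * The spectral sequence of a filtered complex *)

Section FilteredComplex.
Variables (k : pzRingType) (M : lmodType k) (d : {linear M -> M}).
Variable F : int -> int -> submodClosed M.
Hypothesis F_decr : forall p i x, x \in F (p + 1) i -> x \in F p i.
Hypothesis F_d : forall p i x, x \in F p i -> d x \in F p (i + 1).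
Hypothesis dd : forall x, d (d x) = 0.

Local Notation Z r i j := (Zr d F r i j).
Local Notation B r i j := (Br d F r i j).

Lemma in_Zr r i j x :
  (x \in Z r i j) = (x \in F j i) && (d x \in F (j + r%:Z) (i + 1)).
Proof. by []. Qed.

(** Degrees such as [i - 1 + 1] and [i] are identified on memberships only, where no dependent type
    stands in the way. *)
Lemma Zr_cast r i j i' j' x :
  x \in Z r i j -> i = i' -> j = j' -> x \in Z r i' j'.
Proof. by move=> xZ <- <-. Qed.

Lemma in_Br r i j x : x \in B r i j <-> exists y z,
  [/\ y \in Z r.-1 i (j + 1), z \in Z r.-1 (i - 1) (j - r%:Z + 1) & x = y + d z].
Proof.
split=> [/asboolP[y [_ [yZ /asboolP[z zZ ->] ->]]]|[y [z [yZ zZ ->]]]].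
  by exists y, z.
by apply/asboolP; exists y, (d z); split=> //; apply/asboolP; exists z.
Qed.

Lemma F_le p q i x : p <= q -> x \in F q i -> x \in F p i.
Proof.
move=> le_pq; have -> : q = p + `|q - p|%N%:Z by lia.
elim: `|_|%N => [|m IH] xF; first by rewrite addr0 in xF.
by apply/IH/F_decr; move: xF; congr (x \in F _ i); lia.
Qed.

Lemma Zr_incl r i j x : x \in Z r.+1 i j -> x \in Z r i j.
Proof.
by rewrite !in_Zr => /andP[-> /=]; apply: F_le; lia.
Qed.

Lemma Zr_shift r i j x : x \in Z r i (j + 1) -> x \in Z r.+1 i j.
Proof.
rewrite !in_Zr => /andP[/F_decr-> /=]; congr (_ \in F _ _); lia.
Qed.

Lemma cycle_Zr r i j x : d x = 0 -> x \in F j i -> x \in Z r i j.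
Proof. by rewrite in_Zr => -> ->; rewrite rpred0. Qed.

Lemma d_Zr r r' i j x : x \in Z r i j -> d x \in Z r' (i + 1) (j + r%:Z).
Proof. by rewrite in_Zr => /andP[_]; apply: cycle_Zr. Qed.

Lemma Zr_Br r i j x : (0 < r)%N -> x \in Z r.-1 i (j + 1) -> x \in B r i j.
Proof.
by move=> r_gt0 xZ; apply/in_Br; exists x, 0; rewrite !rpred0 linear0 addr0.
Qed.

Lemma d_Br r i j x : x \in Z r.-1 i (j + 1) -> d x \in B r (i + 1) (j + r%:Z).
Proof.
move=> xZ; apply/in_Br; exists 0, x; rewrite rpred0 add0r; split=> //.
by apply: Zr_cast xZ _ _; lia.
Qed.

(** On [y + d z] the second term dies by [dd], and [d y] is a boundary term of the target. This
    makes the differential of the page well defined. *)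
Lemma d_Zr_Br r i j x : x \in B r i j -> d x \in B r (i + 1) (j + r%:Z).
Proof.
by case/in_Br=> y [z [yZ zZ ->]]; rewrite linearD dd addr0 d_Br.
Qed.

Definition ss_page r i j : lmodType k := subquot (Z r i j) (B r i j).

(** A spectral sequence must provide maps between any two bidegrees. Putting the equality of
    bidegrees inside the specification gives one type to the map induced by [d] and to the zero
    map. *)
Lemma ss_dif_exists r i j i' j' :
  {t : {linear ss_page r i j -> ss_page r i' j'} |
    ((0 < r)%N -> (i', j') = (i + 1, j + r%:Z) ->
       forall (z : subm (Z r i j)) (z' : subm (Z r i' j')),
       val z' = d (val z) -> t (cls z) = cls z') /\
    ((i', j') <> (i + 1, j + r%:Z) -> forall x, t x = 0)}.
Proof.
have [[-> ->]|ne] := pselect ((i', j') = (i + 1, j + r%:Z)); last first.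
  by exists \0.
pose dZ := restr (fun x => @d_Zr r r i j x).
pose b : {linear _ -> ss_page r (i + 1) (j + r%:Z)} :=
  @cls k M _ _ \o dZ.
have b0 (z : subm (Z r i j)) : cls z = 0 :> ss_page r i j -> b z = 0.
  by move=> /cls_eq0 zB; apply/cls_eq0/d_Zr_Br.
have [t tE] := linear_factor (@cls_surj _ _ _ _) b0.
exists t; split=> // _ _ z z' z'E; rewrite tE /=; congr cls.
by apply: val_inj; rewrite z'E.
Qed.
Definition ss_dif r i j i' j' := projT1 (ss_dif_exists r i j i' j').

Lemma ss_dif_cls r i j (z : subm (Z r i j))
    (z' : subm (Z r (i + 1) (j + r%:Z))) : (0 < r)%N -> val z' = d (val z) ->
  ss_dif r i j (i + 1) (j + r%:Z) (cls z) = cls z'.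
Proof.
have [tE _] := projT2 (ss_dif_exists r i j (i + 1) (j + r%:Z)).
by move=> r_gt0; apply: tE.
Qed.

Lemma ss_dif_bidegree r i j i' j' : (0 < r)%N ->
  (i', j') <> (i + 1, j + r%:Z) -> forall x, ss_dif r i j i' j' x = 0.
Proof. by move=> _; have [_] := projT2 (ss_dif_exists r i j i' j'). Qed.

Lemma ss_dif_dif r i j i' j' i'' j'' : (0 < r)%N ->
  forall x, ss_dif r i' j' i'' j'' (ss_dif r i j i' j' x) = 0.
Proof.
move=> r_gt0 x.
have [[-> ->]|ne] := pselect ((i', j') = (i + 1, j + r%:Z)); last first.
  by rewrite (ss_dif_bidegree r_gt0 ne) linear0.
have [[-> ->]|ne] :=
    pselect ((i'', j'') = (i + 1 + 1, j + r%:Z + r%:Z)); last first.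
  by rewrite (ss_dif_bidegree r_gt0 ne).
have [z <-] := cls_surj x.
rewrite (@ss_dif_cls _ _ _ z (restr (fun x => @d_Zr r r i j x) z)) //.
by rewrite (@ss_dif_cls _ _ _ _ 0) ?linear0 //= dd.
Qed.

(** * From one page to the next *)

Section Turn.
Variables (r : nat) (i j : int).
Local Notation K := (sm_ker (ss_dif r i j (i + 1) (j + r%:Z))).
Local Notation I := (sm_im (ss_dif r (i - 1) (j - r%:Z) i j) (@sm_full _ _)).

Let incl : {linear subm (Z r.+1 i j) -> subm (Z r i j)} :=
  restr (f := idfun) (@Zr_incl r i j).

Hypothesis r_gt0 : (0 < r)%N.

(** For [w] in Z_(r+1), [d w] lies in filtration [j + r + 1], hence in the summand Z_(r-1) of B_r at
    [(i + 1, j + r)]. *)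
Lemma ss_ker_cls (w : subm (Z r.+1 i j)) : cls (incl w) \in K.
Proof.
have dwZ : d (val w) \in Z r (i + 1) (j + r%:Z) by exact/d_Zr/Zr_incl/valP.
rewrite !inE (@ss_dif_cls _ _ _ _ (subm_of dwZ)) //; apply/eqP/cls_eq0 => /=.
apply: Zr_Br => //.
by apply: Zr_cast (@d_Zr r.+1 r.-1 i j _ (valP w)) _ _; lia.
Qed.

Definition turn_incl_fun w : subm K := Sub (cls (incl w)) (ss_ker_cls w).
Lemma turn_incl_linear : linear turn_incl_fun.
Proof.
move=> a x y; apply: val_inj.
rewrite -[LHS]/((@cls k M _ _ \o incl) (a *: x + y)) linearP.
by rewrite [RHS](linearP (@sub_val k _ K)).
Qed.
Definition turn_incl : {linear subm (Z r.+1 i j) -> subquot K I} :=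
  @cls k _ K I \o linear_of turn_incl_linear.

(** If the differential kills the class of [z], then [d z = y + d z'] with [y] in filtration
    [j + r + 1] and [z'] in Z_(r-1) at [(i, j + 1)]. So [z - z'] lies in Z_(r+1), and it represents
    the same class because [z'] lies in B_r. *)
Lemma turn_incl_surj q : exists w, turn_incl w = q.
Proof.
have [[x xK] <-] := cls_surj q; have [z zE] := cls_surj x.
have dzZ : d (val z) \in Z r (i + 1) (j + r%:Z) by exact: d_Zr (valP _).
have: ss_dif r i j (i + 1) (j + r%:Z) (cls z) = 0.
  by rewrite zE; apply/eqP; move: xK; rewrite inE.
rewrite (@ss_dif_cls _ _ _ _ (subm_of dzZ)) // => /cls_eq0 /in_Br.
rewrite -[val (subm_of _)]/(d (val z)) => -[y [z' [yZ z'Z zyz']]].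
have {}z'Z : z' \in Z r.-1 i (j + 1) by apply: Zr_cast z'Z _ _; lia.
have wZ : val z - z' \in Z r.+1 i j.
  rewrite in_Zr linearB zyz' addrK.
  move: (valP z) yZ z'Z; rewrite !in_Zr => /andP[zF _] /andP[yF _].
  case/andP=> /F_decr z'F _; apply/andP; split; first exact: submB.
  by move: yF; congr (_ \in F _ _); lia.
exists (subm_of wZ); rewrite /turn_incl /=; congr cls.
apply: val_inj; rewrite /= -zE; apply/cls_eq.
rewrite -[val (incl _)]/(val z - z').
by rewrite addrAC subrr sub0r; apply/submN/Zr_Br.
Qed.

(** If the class of [w] is hit by the class of [z], then [w = y + d u + d z] with [y + d u] in B_r.
    Collecting the last two terms into [d (u + z)] gives the shape of an element of B_(r+1). *)
Lemma turn_incl_eq0 w : turn_incl w = 0 <-> val w \in B r.+1 i j.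
Proof.
have in_im x : x \in I <-> exists z : subm (Z r (i - 1) (j - r%:Z)),
    exists2 z' : subm (Z r i j), x = cls z' & val z' = d (val z).
  split=> [/asboolP[q _ ->]|[z [z' ->]]].
    have [z <-] := cls_surj q.
    have dzZ : d (val z) \in Z r i j.
      by apply: Zr_cast (@d_Zr r r _ _ _ (valP z)) _ _; lia.
    exists z, (subm_of dzZ) => //.
    (* [ss_dif_cls] speaks of targets of the form [(i' + 1, j' + r)]; its statement is rewritten to
       the target [(i, j)] before the representative is supplied. *)
    have iE : i - 1 + 1 = i by lia.
    have jE : j - r%:Z + r%:Z = j by lia.
    have := @ss_dif_cls r (i - 1) (j - r%:Z) z.
    by rewrite iE jE => /(_ (subm_of dzZ)); apply.
  move=> zz'; apply/asboolP; exists (cls z) => //.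
  have iE : i - 1 + 1 = i by lia.
  have jE : j - r%:Z + r%:Z = j by lia.
  have := @ss_dif_cls r (i - 1) (j - r%:Z) z.
  by rewrite iE jE => /(_ z' r_gt0 zz') ->.
rewrite -[X in X <-> _]/(cls _ = 0) cls_eq0; split.
  case/in_im=> z [z' zz' z'E]; apply/in_Br.
  have /cls_eq : cls (incl w) = cls z' :> ss_page r i j by exact: zz'.
  rewrite z'E -[val (incl w)]/(val w).
  case/in_Br=> y [u [yZ uZ /eqP]]; rewrite subr_eq => /eqP wE.
  have vZ : u + val z \in Z r (i - 1) (j - r%:Z).
    rewrite rpredD ?(valP z) //; move: uZ => /Zr_shift; rewrite prednK //.
  exists y, (u + val z); split; last by rewrite linearD addrA.
    rewrite in_Zr; move: yZ; rewrite in_Zr => /andP[-> _] /=.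
    (* [d y] equals [d w], which lies in filtration [j + r + 1]. *)
    have -> : y = val w - d (u + val z) by rewrite linearD opprD addrA wE addrAC !addrK.
    rewrite linearB dd subr0; move: (valP w); rewrite in_Zr => /andP[_].
    by have -> : j + r.+1%:Z = j + 1 + r%:Z by lia.
  by apply: Zr_cast vZ _ _; lia.
case/in_Br=> y [z [yZ zZ wE]]; apply/in_im.
have {}zZ : z \in Z r (i - 1) (j - r%:Z) by apply: Zr_cast zZ _ _; lia.
have dzZ : d z \in Z r i j by apply: Zr_cast (@d_Zr r r _ _ _ zZ) _ _; lia.
exists (subm_of zZ), (subm_of dzZ) => //.
apply/cls_eq; rewrite -[val (incl w)]/(val w) wE addrK.
by apply: Zr_Br => //; apply: Zr_incl; rewrite prednK.
Qed.
End Turn.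

Lemma ss_turn_exists r i j :
  {t : {linear subquot (sm_ker (ss_dif r i j (i + 1) (j + r%:Z)))
          (sm_im (ss_dif r (i - 1) (j - r%:Z) i j) (@sm_full _ _))
        -> ss_page r.+1 i j} |
    (0 < r)%N -> bijective t /\ forall (z : subm (Z r i j)) (w : subm (Z r.+1 i j))
        (x : subm (sm_ker (ss_dif r i j (i + 1) (j + r%:Z)))),
        val w = val z -> val x = cls z -> t (cls x) = cls w}.
Proof.
(* Page 0 carries no condition, so the zero map fills it. *)
have [r_gt0|r0] := pselect (0 < r)%N; last by exists \0.
have tB w : turn_incl i j r_gt0 w = 0 -> cls w = 0 :> ss_page r.+1 i j.
  by move/turn_incl_eq0/cls_eq0.
have [t tE] := linear_factor (turn_incl_surj r_gt0) tB.
exists t; split=> [|z w x wz xz].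
  apply: factor_bij (turn_incl_surj r_gt0) (@cls_surj _ _ _ _) _ tE => w.
  by move=> /cls_eq0 wB; apply/turn_incl_eq0.
rewrite -tE; congr (t (cls _)); apply: val_inj; rewrite /= xz.
by congr cls; apply: val_inj; rewrite /= wz.
Qed.
Definition ss_turn r i j := projT1 (ss_turn_exists r i j).

Lemma ss_turn_bij r i j : (0 < r)%N -> bijective (@ss_turn r i j).
Proof. by move=> /(projT2 (ss_turn_exists r i j))[]. Qed.

Definition filtered_ss : spectral_sequence k :=
  SpectralSequence ss_dif_bidegree ss_dif_dif ss_turn_bij.

Lemma filtered_ss_induced : induced_by_filtration d F filtered_ss.
Proof.
exists (fun r i j => idfun : {linear _ -> _}); split=> [r i j _|r i j z z' r0 zz'|].
- by exists idfun.
- exact: ss_dif_cls.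
move=> r i j z w x r_gt0 wz xz.
by have [_ /(_ _ _ _ wz xz)] := projT2 (ss_turn_exists r i j) r_gt0.
Qed.

(** * The first page *)

Section GradedPage.
Variables (d0 : {linear M -> M}) (C0 : int -> int -> submodClosed M).
Hypothesis C0_sub : forall i j x, x \in C0 i j -> x \in F j i.
Hypothesis C0_split : forall i j x, x \in F j i ->
  exists2 x0, x0 \in C0 i j & x - x0 \in F (j + 1) i.
Hypothesis C0_cap : forall i j x, x \in C0 i j -> x \in F (j + 1) i -> x = 0.
Hypothesis d0_C0 : forall i j x, x \in C0 i j -> d0 x \in C0 (i + 1) j.
Hypothesis d_d0 : forall i j x, x \in C0 i j ->
  d x - d0 x \in F (j + 1) (i + 1).

Lemma Z0E i j x : (x \in Z 0 i j) = (x \in F j i).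
Proof.
rewrite in_Zr addr0; case: (boolP (x \in F j i)) => //= xF.
by rewrite F_d.
Qed.

(** A class on the first page is represented by its leading term in [C0], and [d0] is the leading
    part of [d]. Both sides are thus quotients of the [d0]-cycles by the same kernel. *)
Lemma homology_ss_page1 i j :
  lmod_iso (ss_page 1 i j) (homology d0 (fun i' => C0 i' j) i).
Proof.
have inZ x : x \in cycles d0 (fun i' => C0 i' j) i -> idfun x \in Z 1 i j.
  case/andP=> xC; rewrite inE => /eqP d0x.
  by rewrite in_Zr C0_sub //= -[d x]subr0 -d0x d_d0.
pose a : {linear _ -> ss_page 1 i j} := @cls k M _ _ \o restr inZ.
pose b : {linear _ -> homology d0 (fun i' => C0 i' j) i} := @cls k M _ _.
apply: (lmod_iso_factor (a := a) (b := b)) => [q||w].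
- have [z <-] := cls_surj q; have := valP z; rewrite in_Zr => /andP[zF dzF].
  have [z0 z0C zz0] := C0_split zF.
  have z0Z : z0 \in cycles d0 (fun i' => C0 i' j) i.
    apply/andP; split=> //; rewrite inE; apply/eqP; apply: (C0_cap (d0_C0 z0C)).
    (* The right-hand side lies in filtration [j + 1] while [d0 z0] is homogeneous of degree [j], so
       [C0_cap] makes it vanish. *)
    have -> : d0 z0 = d (val z) - d (val z - z0) - (d z0 - d0 z0).
      by rewrite linearB !subKr.
    by apply: submB; [apply: submB => //; apply: F_d | apply: d_d0].
  exists (subm_of z0Z); apply/cls_eq; rewrite -[val (restr _ _)]/z0.
  by rewrite -opprB submN //; apply: Zr_Br; rewrite ?Z0E.
- exact: cls_surj.
rewrite -[a w = 0]/(cls _ = 0) !cls_eq0 -[val (restr _ _)]/(val w).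
have /andP[wC] := valP w; rewrite inE => /eqP d0w; split.
  case/in_Br=> y [z []]; rewrite !Z0E => yF.
  have -> : j - 1 + 1 = j by lia.
  case/C0_split=> z0 z0C zz0 wE; apply/asboolP; exists z0 => //.
  apply/eqP; rewrite -subr_eq0; apply/eqP.
  have d0z0 : d0 z0 \in C0 i j by have := d0_C0 z0C; rewrite subrK.
  apply: (C0_cap (submB wC d0z0)).
  (* Again a homogeneous element of degree [j] is a sum of terms in filtration [j + 1]; hence [w] is
     the [d0]-boundary of the leading term of [z]. *)
  have -> : val w - d0 z0 = y + (d (z - z0) + (d z0 - d0 z0)).
    by rewrite wE linearB (addrA (d z - d z0)) subrK addrA.
  have := d_d0 z0C; have := F_d zz0; rewrite subrK => *.
  by do 2?apply: rpredD.
case/asboolP=> z zC wE; apply/in_Br.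
exists (d0 z - d z), z; rewrite !Z0E; split; last by rewrite subrK.
  by rewrite -opprB submN //; have := d_d0 zC; rewrite subrK.
by have := C0_sub zC; congr (_ \in F _ _); lia.
Qed.
End GradedPage.

(** * Convergence *)

Section Limit.
Variable C : int -> submodClosed M.
Hypothesis F_sub : forall p i x, x \in F p i -> x \in C i.
Variables (p0 p1 : int).
Hypothesis F_full : forall p i x, p <= p0 -> x \in C i -> x \in F p i.
Hypothesis F_zero : forall p i x, p1 <= p -> x \in F p i -> x = 0.

Local Notation Fil := (homology_filtration d C F).
Local Notation H i := (homology d C i).

Lemma in_Fil i p (h : H i) : h \in Fil i p <->
  exists2 x : subm (cycles d C i), val x \in F p i & h = cls x.
Proof. by split=> [/asboolP[x]|[x]]; [|move=> *; apply/asboolP]; exists x. Qed.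

Lemma Fil_decr i p : {subset Fil i (p + 1) <= Fil i p}.
Proof. by move=> h /in_Fil[x /F_decr xF ->]; apply/in_Fil; exists x. Qed.

Lemma Fil_full i p (h : H i) : p <= p0 -> h \in Fil i p.
Proof.
move=> pp0; have [x <-] := cls_surj h; apply/in_Fil; exists x => //.
by have /andP[xC _] := valP x; apply: F_full.
Qed.

Lemma Fil_zero i p (h : H i) : p1 <= p -> h \in Fil i p -> h = 0.
Proof.
move=> pp1 /in_Fil[x /(F_zero pp1) x0 ->]; apply/cls_eq0.
by rewrite x0 rpred0.
Qed.

Definition ss_limit i j : lmodType k := subquot (Fil i j) (Fil i (j + 1)).

(** Once [j + r >= p1] and [j - r + 1 <= p0], Z_r consists of the cycles in F^j, and B_r of the
    cycles in F^(j+1) plus the boundaries lying in F^j. The quotient is the graded piece of the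
    homology. *)
Lemma filtered_ss_limit : is_infinity_page filtered_ss ss_limit.
Proof.
move=> i j; exists (1 + `|p1 - j| + `|p0 - j|)%N => // r r0r; have r_gt0 : (0 < r)%N by lia.
split=> [i' j' x|i' j' x|].
- have [[-> ->]|ne] := pselect ((i', j') = (i + 1, j + r%:Z)); last first.
    exact: ss_dif_bidegree.
  rewrite /=; set y := ss_dif _ _ _ _ _ _; have [z <-] := cls_surj y.
  apply/cls_eq0; have /andP[zF _] := valP z.
  by rewrite (F_zero _ zF) ?rpred0 //; lia.
- have [E|ne] := pselect ((i, j) = (i' + 1, j' + r%:Z)); last first.
    exact: ss_dif_bidegree.
  have jE : j' + 1 <= p0 by case: E => _; lia.
  have [z <-] := cls_surj x; have [-> ->] := E.
  have dzZ : d (val z) \in Z r (i' + 1) (j' + r%:Z) by exact: d_Zr (valP z).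
  rewrite /= (@ss_dif_cls _ _ _ _ (subm_of dzZ)) //; apply/cls_eq0.
  (* As [F (j' + 1)] is the whole module of chains, [z] already lies in Z_(r-1) at [(i', j' + 1)],
     so [d z] lies in B_r. *)
  apply: d_Br; have := valP z; rewrite !in_Zr => /andP[zF dzF].
  apply/andP; split; first exact: F_full (F_sub zF).
  by move: dzF; congr (_ \in F _ _); lia.
have F0 p i' x : p1 <= p -> (x \in F p i') = (x == 0).
  by move=> pp1; apply/idP/eqP => [/(F_zero pp1)|->]; rewrite ?rpred0.
have inH x : x \in Z r i j -> idfun x \in cycles d C i.
  rewrite in_Zr (F0 (j + r%:Z)); last by lia.
  by case/andP=> xF dx0; apply/andP; split; [exact: F_sub xF | rewrite inE].
have inFil (x : subm (Z r i j)) :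
    (@cls k M _ (boundaries d C i) \o restr inH) x \in Fil i j.
  by apply/in_Fil; exists (restr inH x) => //; case/andP: (valP x).
pose c : {linear _ -> H i} := @cls k M _ _ \o restr inH.
have c_linear : linear (fun x => subm_of (inFil x)).
  by move=> a x y; apply: val_inj; rewrite [LHS](linearP c) [RHS](linearP (@sub_val k _ _)).
pose b : {linear _ -> ss_limit i j} := @cls k _ _ _ \o linear_of c_linear.
apply: (lmod_iso_factor (a := @cls k M _ (B r i j)) (b := b)) => [|q|w].
- exact: cls_surj.
- have [[h hF] <-] := cls_surj q; have /in_Fil[x xF hE] := hF.
  have xZ : val x \in Z r i j.
    by apply: cycle_Zr xF; case/andP: (valP x) => _; rewrite inE => /eqP.
  exists (subm_of xZ); congr cls; apply: val_inj => /=; rewrite hE.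
  by congr cls; apply: val_inj.
rewrite -[b w = 0]/(cls _ = 0) !cls_eq0 in_Fil.
have cZ x : x \in F (j + 1) i -> d x = 0 -> x \in Z r.-1 i (j + 1).
  by move=> xF dx0; apply: cycle_Zr.
have d0 (x : subm (cycles d C i)) : d (val x) = 0.
  by have /andP[_] := valP x; rewrite inE => /eqP.
have dw0 : d (val w) = 0 := d0 (restr inH w).
split=> [/in_Br[y [z [yZ zZ wE]]]|[x xF /cls_eq/asboolP[z zC wE]]].
  have dy0 : d y = 0.
    by apply/eqP; rewrite -dw0 wE linearD dd addr0.
  have /andP[yF _] := yZ.
  have yH : y \in cycles d C i.
    by apply/andP; split; [exact: F_sub yF | rewrite inE dy0].
  exists (subm_of yH) => //; apply/cls_eq/asboolP; exists z.
    by apply: F_sub; case/andP: zZ => zF _; apply: zF.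
  by rewrite -[val (restr _ _)]/(val w) wE addrC addKr.
apply/in_Br; exists (val x), z; split; first exact: cZ.
  have dzF : d z \in F j i.
    by rewrite -wE; apply: submB (F_decr xF); case/andP: (valP w).
  apply/andP; split; first by apply: F_full zC; lia.
  by rewrite subrK; move: dzF; congr (_ \in F _ _); lia.
by apply/eqP; rewrite addrC -subr_eq; apply/eqP.
Qed.
End Limit.
End FilteredComplex.

(** * Splitting a filtration *)

(** Preimages inside [D] are unique because [D] meets the kernel of [f] trivially, and uniqueness
    makes their choice linear. *)
Lemma linear_section (k : pzRingType) (U P : lmodType k) (f : {linear U -> P})
    (D : U -> Prop) :
    (forall a x y, D x -> D y -> D (a *: x + y)) ->
    (forall x, D x -> f x = 0 -> x = 0) ->
    (forall y, exists2 x, D x & f x = y) ->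
  exists g : {linear P -> U}, forall y, f (g y) = y.
Proof.
move=> D_lin D_inj D_surj; pose g y := s2val (cid2 (D_surj y)).
have fg y : f (g y) = y by rewrite /g; case: cid2.
have gD y : D (g y) by rewrite /g; case: cid2.
have gL : linear g.
  move=> a x y; apply/eqP; rewrite -subr_eq0; apply/eqP/D_inj.
    rewrite [X in D X]addrC -scaleN1r.
    exact: (D_lin _ _ _ (D_lin _ _ _ (gD x) (gD y)) (gD _)).
  by rewrite linearB linearP !fg subrr.
by exists (linear_of gL).
Qed.

(* Zorn's lemma yields a submodule of the source which is maximal among those
   on which the surjection is injective. *)
Lemma field_projective (k : comPzRingType) (P : lmodType k) :
  is_field k -> projective P.
Proof.
case=> _ inv U f f_surj.
pose lin (D : classical_sets.set U) := forall a x y, D x -> D y -> D (a *: x + y).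
pose inj (D : classical_sets.set U) := forall x, D x -> f x = 0 -> x = 0.
have [F FP Ftot|D [[D_lin D_inj] D_max]] :=
    @classical_sets.Zorn_bigcup U (fun D => lin D /\ inj D).
  split=> [a x y [X FX Xx] [Y FY Yy]|x [X FX Xx]]; last exact: (FP X FX).2.
  have [XY|YX] := Ftot _ _ FX FY.
    by exists Y => //; apply: (FP Y FY).1 => //; apply: XY.
  by exists X => //; apply: (FP X FX).1 => //; apply: YX.
apply: (linear_section D_lin D_inj) => y; apply: contrapT => yD.
have [x fx] := f_surj y.
(* The empty set satisfies [lin] and [inj], so 0 could be missing from [D]; adjoining it shows by
   maximality that it is not. *)
pose D0 z := z = 0 \/ D z.
have D0_lin a z t : D0 z -> D0 t -> D0 (a *: z + t).
  move=> [->|Dz] [->|Dt]; rewrite ?scaler0 ?addr0; [by left|by right; rewrite add0r| |].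
    right; have := D_lin (a - 1) z z Dz Dz.
    by rewrite scalerBl scale1r subrK.
  by right; apply: D_lin.
have D_0 : D 0.
  apply: contrapT => nD0; apply: (D_max D0); last split=> //.
    by split=> [z Dz|/(_ 0 (or_introl erefl))//]; right.
  by move=> z [->//|]; apply: D_inj.
(* If [y] is not reached, the line through a preimage [x] of [y] can be added to [D]: an element
   [z + b *: x] of the kernel with [b] nonzero would express [y] as a multiple of [f z]. *)
pose D' z := exists2 t, D t & exists a, z = t + a *: x.
apply: (D_max D'); first split=> [z Dz|D'D].
- by exists z => //; exists 0; rewrite scale0r addr0.
- apply: yD; exists x => //; apply: D'D.
  by exists 0 => //; exists 1; rewrite add0r scale1r.
split=> [a _ _ [z Dz [b ->]] [t Dt [c ->]]|_ [z Dz [b ->]]].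
  exists (a *: z + t); first exact: D_lin.
  by exists (a * b + c); rewrite scalerDr scalerDl scalerA addrACA.
rewrite linearD linearZ /= fx => fzx.
have [b0|b_neq0] := eqVneq b 0.
  by move: fzx; rewrite b0 !scale0r !addr0; apply: D_inj.
have [c bc] := inv b b_neq0; case: yD; exists (- c *: z + 0); first exact: D_lin.
rewrite addr0 linearZ /= scaleNr -scalerN.
have -> : - f z = b *: y by rewrite -[LHS]addr0 -fzx addKr.
by rewrite scalerA mulrC bc scale1r.
Qed.

Section Splitting.
Variables (k : pzRingType) (H : lmodType k) (Fil : int -> submodClosed H).
Variables (p0 p1 : int).
Hypothesis Fil_decr : forall p, {subset Fil (p + 1) <= Fil p}.
Hypothesis Fil_full : forall p h, p <= p0 -> h \in Fil p.
Hypothesis Fil_zero : forall p h, p1 <= p -> h \in Fil p -> h = 0.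

Lemma Fil_le p q h : p <= q -> h \in Fil q -> h \in Fil p.
Proof.
move=> le_pq; have -> : q = p + `|q - p|%N%:Z by lia.
elim: `|_|%N => [|m IH]; first by rewrite addr0.
have -> : p + m.+1%:Z = p + m%:Z + 1 by lia.
by move=> /Fil_decr/IH.
Qed.

Local Notation gr := (fun j => subquot (Fil j) (Fil (j + 1)) : lmodType k).

(** Projectivity lifts each graded piece into [Fil j]. Generation peels off leading classes, by
    induction from [Fil p1] downwards. Independence goes upwards: once the components of smaller
    index vanish, [phi j (e j)] lies in [Fil (j + 1)], so its class [e j] is zero. *)
Lemma split_filtration : (forall j, projective (gr j)) ->
  isom_direct_sum gr H.
Proof.
move=> gr_proj.
have g_exists j : {g : {linear gr j -> subm (Fil j)} | forall q, cls (g q) = q}.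
  exact: cid (gr_proj j _ (@cls k H _ _) (@cls_surj _ _ _ _)).
pose g j := projT1 (g_exists j).
have gE j (q : gr j) : cls (g j q) = q := projT2 (g_exists j) q.
pose phi j : {linear gr j -> H} := @sub_val k H (Fil j) \o g j.
have phi_in j q : phi j q \in Fil j := valP (g j q).
exists phi; split=> [h|s e s_uniq s0].
  suff hE m h' : h' \in Fil (p1 - m%:Z) -> exists s (e : forall j, gr j),
      {in s, forall j, p1 - m%:Z <= j} /\ h' = \sum_(j <- s) phi j (e j).
    have [|s [e [_ ->]]] := hE `|p1 - p0|%N h; last by exists s, e.
    by apply: Fil_full; lia.
  elim: m h' => [|m IH] h' h'F.
    exists [::], (fun=> 0); split=> //; rewrite big_nil.
    by apply: Fil_zero h'F; lia.
  set j := p1 - m.+1%:Z; pose x : gr j := cls (subm_of h'F).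
  have jE : j + 1 = p1 - m%:Z by rewrite /j; lia.
  have [|s [e [s_ge hE]]] := IH (h' - phi j x).
    by rewrite -jE; apply/(cls_eq _ (subm_of h'F)); rewrite gE.
  (* Every index in [s] exceeds [j], so overriding [e] at [j] leaves the other terms alone. *)
  exists (j :: s), (dfwith e x); split=> [i|].
    by rewrite inE => /orP[/eqP->//|/s_ge]; rewrite -jE; lia.
  rewrite big_cons dfwith_in -[LHS](subrK (phi j x)) addrC hE; congr (_ + _).
  rewrite !big_seq; apply: eq_bigr => i /s_ge ij; rewrite dfwith_out //.
  by apply/eqP; lia.
suff e0 m j : j \in s -> j < p0 + m%:Z -> e j = 0.
  by move=> j js; apply: (e0 (1 + `|j - p0|)%N) => //; lia.
elim: m j => [|m IH] j js jm; rewrite -[e j]gE; apply/cls_eq0.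
  by apply: Fil_full; lia.
have : phi j (e j) = - \sum_(i <- s | i != j) phi i (e i).
  by apply/eqP; rewrite -addr_eq0 -(bigD1_seq j) ?s0.
rewrite -[val _]/(phi j (e j)) => ->; apply: submN.
rewrite big_seq_cond; apply: rpred_sum => i /andP[is_ ij].
have [lt_ij|le_ji] := Order.TotalTheory.ltP i j.
  by rewrite (IH i is_) ?linear0 ?rpred0 //; lia.
by apply: Fil_le (phi_in i _); lia.
Qed.
End Splitting.

(** * Circles of a state *)

Lemma even_card_involution (T : finType) (f : T -> T) (K : {set T}) :
  involutive f -> (forall x, f x != x) -> {in K, forall x, f x \in K} ->
  ~~ odd #|K|.
Proof.
move=> fK f_neq; have [m] := ubnP #|K|; elim: m K => // m IH K leKm Kf.
have [->|[x xK]] := set_0Vmem K; first by rewrite cards0.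
have fxK : f x \in K :\ x by rewrite !inE f_neq Kf.
have KE : #|K| = #|K :\ x :\ f x|.+2 by rewrite (cardsD1 x) xK (cardsD1 (f x)) fxK.
rewrite KE /= negbK IH //; first by rewrite KE in leKm; lia.
move=> y; rewrite !inE => /and3P[yfx yx yK]; rewrite (inj_eq (inv_inj fK)) yx Kf //.
by rewrite andbT; apply: contra yfx => /eqP <-; rewrite fK.
Qed.

Lemma eq_connect_closed (T : finType) (e e' : rel T) (A : pred T) x :
    {in A, e =2 e'} -> (forall y z, A y -> e y z -> A z) -> A x ->
  connect e x =1 connect e' x.
Proof.
move=> ee' Ae Ax y; apply/connectP/connectP=> -[s]; elim: s x Ax => [|z s IH] x Ax /=.
- by move=> _ ->; exists [::].
- case/andP=> exz sz yE; have [t tz tE] := IH z (Ae _ _ Ax exz) sz yE.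
  by exists (z :: t) => //=; rewrite -ee' ?exz.
- by move=> _ ->; exists [::].
case/andP=> exz sz yE; rewrite -ee' // in exz.
have [t tz tE] := IH z (Ae _ _ Ax exz) sz yE.
by exists (z :: t) => //=; rewrite exz.
Qed.

Section Circles.
Variables (G : graph) (Gam : ribbon G).
Implicit Types (alpha beta : {set hedge G}) (h : hedge G).

(** Away from vertex-less edges, the boundary is the union of two perfect matchings of the boundary
    points: along arcs of the vertex discs, and along sides of bands. Each matching is encoded as an
    involution without fixed points. *)
Definition disc_end (p : hedge G * bool) : hedge G * bool :=
  if p.2 then (rot Gam p.1, false) else ((rot Gam)^-1%g p.1, true).

Definition band_end alpha (p : hedge G * bool) : hedge G * bool :=
  (opp p.1, p.2 (+) ~~ band_twist Gam alpha p.1).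

Lemma opp_inj : injective (@opp G).
Proof. exact: inv_inj (@oppK G). Qed.

Lemma disc_endK : involutive disc_end.
Proof. by case=> h []; rewrite /disc_end /= ?permK ?permKV. Qed.

Lemma disc_end_neq p : disc_end p != p.
Proof. by case: p => h []; rewrite /disc_end xpair_eqE /= andbF. Qed.

Lemma band_twist_opp alpha h : band_twist Gam alpha (opp h) = band_twist Gam alpha h.
Proof. by rewrite /band_twist twist_opp oppK -!addbA (addbC (_ \in _)). Qed.

Lemma band_endK alpha : involutive (band_end alpha).
Proof.
by case=> h b; rewrite /band_end /= band_twist_opp oppK -addbA addbb addbF.
Qed.

Lemma band_end_neq alpha p : band_end alpha p != p.
Proof. by case: p => h b; rewrite xpair_eqE negb_and /= opp_neq. Qed.

Lemma boundary_arcE alpha p q :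
  boundary_arc Gam alpha (inl p) (inl q) =
    (q == disc_end p) || (q == band_end alpha p).
Proof.
case: p q => [h b] [h' b']; rewrite /disc_end /band_end /=.
rewrite xpair_eqE /= orbA; congr (_ || _).
rewrite (eq_sym h) (can2_eq (permK (rot Gam)) (permKV (rot Gam))).
by case: b b' => -[]; rewrite xpair_eqE /= ?andbF ?andbT ?orbF.
Qed.

Lemma boundary_arc_sym alpha : symmetric (boundary_arc Gam alpha).
Proof.
have sym_inl p q : boundary_arc Gam alpha (inl p) (inl q) =
    boundary_arc Gam alpha (inl q) (inl p).
  rewrite !boundary_arcE !(eq_sym q) (can2_eq disc_endK disc_endK).
  by rewrite (can2_eq (band_endK alpha) (band_endK alpha)).
move=> [[h b]|[c b]] [[h' b']|[c' b']] //.
by rewrite /= (eq_sym c) (eq_sym b); case: eqP => // ->.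
Qed.

Lemma same_circle_sym alpha : connect_sym (boundary_arc Gam alpha).
Proof. exact/sym_connect_sym/boundary_arc_sym. Qed.

(** A condition on twists rather than on membership of [h]: it is symmetric, so each fact proved for
    a step also holds for its reverse. *)
Definition toggled h alpha beta := forall h', band_twist Gam beta h' =
  band_twist Gam alpha h' (+) ((h' == h) || (h' == opp h)).

Lemma toggledU1 h alpha : h \notin alpha -> toggled h alpha (h |: alpha).
Proof.
move=> hA h'; rewrite /band_twist !inE (can2_eq (@oppK G) (@oppK G)).
have [->|ne1] := eqVneq h' h; first by rewrite (negPf hA) (eq_sym h (opp h)) (negPf (opp_neq h)) addbT /=; case: twist; case: (_ \in _).
have [->|ne2] := eqVneq h' (opp h); last by rewrite addbF.
by rewrite oppK (negPf hA) !addbF addbT.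
Qed.

Lemma toggled_sym h alpha beta : toggled h alpha beta -> toggled h beta alpha.
Proof. by move=> t h'; rewrite t addbK. Qed.

Section Toggle.
Variables (h : hedge G) (alpha beta : {set hedge G}).
Hypothesis ab : toggled h alpha beta.
Local Notation p := (inl (h, false) : bpoint G).
Local Notation q := (inl (h, true) : bpoint G).

(** A parity argument excludes two circles through [h] both before and after. Cut the band of [h].
    The component of [p] under the remaining arcs, paired up by [disc_end], is even; so is its part
    away from the cut, paired up by [band_end]. It therefore contains a second end of the cut band:
    either [q], or a point at [opp h], which a side of the band joins to [q] in exactly one of the
    two states. *)
Lemma same_circle_toggle :
  same_circle Gam alpha p q || same_circle Gam beta p q.
Proof.
pose at_h (x : hedge G * bool) := (x.1 == h) || (x.1 == opp h).
pose e (x y : hedge G * bool) :=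
  (y == disc_end x) || ~~ at_h x && (y == band_end alpha x).
have at_h_band x : at_h (band_end alpha x) = at_h x.
  rewrite /at_h /= (can2_eq (@oppK G) (@oppK G)) (inj_eq opp_inj).
  by rewrite orbC.
have e_sub a x y : a = alpha \/ a = beta -> connect e x y ->
    same_circle Gam a (inl x) (inl y).
  move=> aE /connectP[s]; elim: s x => [|z s IH] x /=.
    by move=> _ ->; exact: connect0.
  case/andP=> exz /IH + yE => /(_ yE); apply: connect_trans; apply: connect1.
  rewrite boundary_arcE; case/orP: exz => [->//|/andP[xh /eqP->]].
  case: aE => ->; rewrite ?eqxx ?orbT //.
  by rewrite /band_end ab -/(at_h x) (negPf xh) addbF eqxx orbT.
pose K := [set x | connect e (h, false) x].
pose A := [set x in K | at_h x].
have evenK : ~~ odd #|K|.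
  apply: (even_card_involution disc_endK disc_end_neq) => x; rewrite !inE.
  by move=> xK; apply: connect_trans xK (connect1 _); rewrite /e eqxx.
have evenKA : ~~ odd #|K :\: A|.
  apply: (even_card_involution (band_endK alpha) (@band_end_neq alpha)) => x.
  rewrite !inE at_h_band => /andP[xh xK]; move: xh; rewrite xK /= andbC => xh.
  have bK : connect e (h, false) (band_end alpha x).
    by apply: connect_trans xK (connect1 _); rewrite /e xh eqxx orbT.
  by rewrite bK (negPf xh).
have evenA : ~~ odd #|A|.
  move: evenK; rewrite -(cardsID A) oddD (negPf evenKA) addbF.
  by rewrite (setIidPr _) //; apply/subsetP=> x; rewrite inE => /andP[].
have pA : (h, false) \in A by rewrite !inE connect0 /at_h eqxx.
have [x] : exists x, x \in A :\ (h, false).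
  apply/set0Pn; rewrite -cards_eq0; apply: contra evenA => /eqP A0.
  by rewrite (cardsD1 (h, false)) pA A0.
rewrite !inE; case: x => h' b /and3P[ne px /orP[]/eqP /= h'E]; subst h'.
  case: b ne px => [_ px|]; last by rewrite eqxx.
  by rewrite (e_sub _ _ _ (or_introl erefl) px).
have q_arc a : same_circle Gam a (inl (band_end a (h, true))) q.
  by rewrite /same_circle same_circle_sym connect1 // boundary_arcE eqxx orbT.
apply/orP; have [bE|bE] := eqVneq b (band_twist Gam alpha h); [left|right].
  have := q_arc alpha; rewrite /band_end /= -bE.
  by rewrite negbK; apply: connect_trans (e_sub _ _ _ (or_introl erefl) px).
have := q_arc beta; rewrite (_ : band_end _ _ = (opp h, b)).
  by apply: connect_trans (e_sub _ _ _ (or_intror erefl) px).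
rewrite /band_end /= ab eqxx addbT; congr (_, _).
by case: (b) bE; case: (band_twist _ _ _).
Qed.

Definition touched a x := same_circle Gam a p x || same_circle Gam a q x.

(** A circle running along the toggled band passes through [p] or [q], even if it is met at the
    [opp h] end. On the other circles the arcs of both states coincide. *)
Lemma untouched_connect x : ~~ touched alpha x ->
  same_circle Gam alpha x =1 same_circle Gam beta x.
Proof.
apply: (@eq_connect_closed _ _ _ (fun x => ~~ touched alpha x)) => [y|y z].
  rewrite /in_mem /= => yt z; case: y z yt => [[y1 y2]|[c b]] [[z1 z2]|[c' b']] // yt.
  move: (y1, y2) (z1, z2) yt => y {z1 z2} z yt.
  rewrite !boundary_arcE /band_end ab.
  have [yE|_] := eqVneq y.1 h.
    by case: y yE yt => y [] /= ->; rewrite /touched /same_circle connect0 ?orbT.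
  have [yE|_] := eqVneq y.1 (opp h); last by rewrite addbF.
  have yE' : y = band_end alpha (band_end alpha y) by rewrite band_endK.
  have h1 : (band_end alpha y).1 = h by rewrite /= yE oppK.
  case/negP: yt; rewrite /touched /same_circle.
  case: (band_end alpha y) h1 yE' => h' b /= -> ->.
  by apply/orP; case: b; [right|left]; rewrite connect1 // boundary_arcE eqxx orbT.
rewrite /touched !negb_or => /andP[py qy] yz.
have zy : connect (boundary_arc Gam alpha) z y.
  by rewrite same_circle_sym connect1.
by apply/andP; split; [apply: contra py | apply: contra qy] => /connect_trans; apply.
Qed.
End Toggle.

Lemma touched_toggle h alpha beta x : toggled h alpha beta ->
  touched h beta x = touched h alpha x.
Proof.
suff sub a b : toggled h a b -> ~~ touched h a x -> ~~ touched h b x.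
  move=> ab; apply: negb_inj; apply/idP/idP; apply: sub => //.
  exact: toggled_sym.
move=> ab xa; rewrite /touched /same_circle !(same_circle_sym _ _ x).
rewrite -!/(same_circle _ _ _ _) -!(untouched_connect ab xa).
by rewrite /same_circle !(same_circle_sym _ x).
Qed.

Definition circle_fun (T : Type) alpha (F : bpoint G -> T) :=
  forall x y, same_circle Gam alpha x y -> F x = F y.

Definition circles alpha := roots (boundary_arc Gam alpha).

Section BigCircles.
Variables (R : Type) (idx : R) (op : Monoid.com_law idx).
Variables (h : hedge G) (F : bpoint G -> R).
Local Notation p := (inl (h, false) : bpoint G).
Local Notation q := (inl (h, true) : bpoint G).

(** Isolates the one or two circles through [h]. It serves the products of characters as well as the
    sums of degrees. *)
Lemma big_circles alpha : circle_fun alpha F ->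
  \big[op/idx]_(x | circles alpha x) F x =
    op (if same_circle Gam alpha p q then F p else op (F p) (F q))
       (\big[op/idx]_(x | circles alpha x && ~~ touched h alpha x) F x).
Proof.
move=> FC; rewrite (bigID (touched h alpha)) /=; congr (op _ _).
pose rt := fingraph.root (boundary_arc Gam alpha).
have csym := same_circle_sym alpha.
have Frt x : F (rt x) = F x by apply/esym/FC/connect_root.
rewrite (eq_bigl (fun x => (x == rt p) || (x == rt q))); last first.
  move=> x; rewrite /touched /same_circle -!(root_connect csym) -/rt !(eq_sym x).
  rewrite /circles /roots -/rt; apply/andP/orP => [[/eqP->]|xE].
    by move/orP.
  have rx : rt x = x by case: xE => /eqP<-; rewrite /rt (root_root csym).
  by rewrite rx eqxx; split=> //; apply/orP.
have [pq|pq] := ifP.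
  have -> : rt q = rt p by apply/esym/(fingraph.rootP csym).
  by rewrite (eq_bigl (pred1 (rt p))) ?big_pred1_eq // => x; rewrite orbb.
have rpq : rt q != rt p by rewrite eq_sym /rt root_connect // -/(same_circle _ _ _ _) pq.
rewrite (bigD1 (rt p)) ?eqxx //= Frt -(Frt q); congr (op _ _).
apply: big_pred1 => x /=; have [->|xp] := eqVneq x (rt p).
  by rewrite eq_sym (negPf rpq).
by rewrite andbT.
Qed.

Lemma big_untouched alpha beta : toggled h alpha beta ->
  \big[op/idx]_(x | circles beta x && ~~ touched h beta x) F x =
  \big[op/idx]_(x | circles alpha x && ~~ touched h alpha x) F x.
Proof.
move=> ab; apply: eq_bigl => x; rewrite (touched_toggle x ab).
have [|xa] := boolP (touched h alpha x); rewrite ?andbF ?andbT //.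
(* The root of a point is picked from its [connect] class alone, so an untouched circle keeps its
   root. *)
by rewrite /circles /roots /fingraph.root (eq_pick (untouched_connect ab xa)).
Qed.
End BigCircles.
End Circles.

(** * Matrix entries of the steps *)

Section StepCoefficients.
Variables (G : graph) (Gam : ribbon G) (n : nat).
Implicit Types (alpha : {set hedge G}) (h : hedge G) (f g e : mono G n).
Local Notation p h := (inl (h, false) : bpoint G).
Local Notation q h := (inl (h, true) : bpoint G).
Local Notation same := (same_circle Gam).

Lemma state_monoP alpha f :
  reflect (circle_fun Gam alpha f) (is_state_mono Gam alpha f).
Proof.
apply: (iffP forallP) => [fC x y xy|fC x].
  by have /forallP/(_ y) := fC x; rewrite xy => /eqP.
by apply/forallP=> y; apply/implyP=> /fC->.
Qed.

Definition compatible alpha h f g :=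
  [&& is_state_mono Gam alpha f, is_state_mono Gam (h |: alpha) g
    & [forall x, ~~ touched Gam h alpha x ==> (g x == f x)]].

Definition admissible alpha h f g : bool := compatible alpha h f g &&
  if ~~ same alpha (p h) (q h) then
    (f (p h) + f (q h) == g (p h) %[mod n])%N
  else if ~~ same (h |: alpha) (p h) (q h) then
    (g (p h) + g (q h) == f (p h) + 2 * n./2 %[mod n])%N
  else (f (p h) + n./2 == g (p h) %[mod n])%N.

Definition is_eta alpha h : bool :=
  same alpha (p h) (q h) && same (h |: alpha) (p h) (q h).

Lemma edge_coefE (k : comPzRingType) (s : k) alpha h f g :
  edge_coef Gam (filtered_structure n s) alpha h f g =
    s ^+ is_eta alpha h *+ admissible alpha h f g.
Proof.
rewrite /edge_coef /admissible /is_eta.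
have -> : compatible alpha h f g = [&& is_state_mono Gam alpha f,
  is_state_mono Gam (h |: alpha) g & [forall x, ~~ same alpha (p h) x &&
    ~~ same alpha (q h) x ==> (g x == f x)]].
  by congr [&& _, _ & _]; apply: eq_forallb => x; rewrite negb_or.
case: ifP => // _ /=.
by case: (same alpha _ _); case: (same (h |: alpha) _ _).
Qed.

(** The part of a two-step matrix entry that is independent of the ring: the power of [s] is the
    same for all intermediate [g], so only their number remains. *)
Definition two_step_count alpha h1 h2 f e : nat :=
  \sum_g admissible alpha h1 f g * admissible (h1 |: alpha) h2 g e.

Definition two_step_eta alpha h1 h2 : nat :=
  is_eta alpha h1 + is_eta (h1 |: alpha) h2.

Lemma two_step_coefE (k : comPzRingType) (s : k) alpha h1 h2 f e :
  \sum_g edge_coef Gam (filtered_structure n s) alpha h1 f g *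
         edge_coef Gam (filtered_structure n s) (h1 |: alpha) h2 g e =
  s ^+ two_step_eta alpha h1 h2 *+ two_step_count alpha h1 h2 f e.
Proof.
rewrite -sumrMnr; apply: eq_bigr => g _.
by rewrite !edge_coefE mulrnAl mulrnAr -mulrnA mulnC exprD.
Qed.

(** Every monomial compatible with [f] has this form, which turns sums over [g] into sums over the
    exponents of the new circles. *)
Definition glue alpha h f (i j : 'I_n) : mono G n := [ffun x =>
  if same (h |: alpha) (p h) x then i
  else if same (h |: alpha) (q h) x then j else f x].

Section Glue.
Variables (alpha : {set hedge G}) (h : hedge G).
Hypothesis hA : h \notin alpha.
Local Notation alpha' := (h |: alpha).

Lemma touchedU1 x : touched Gam h alpha' x = touched Gam h alpha x.
Proof. exact: touched_toggle (toggledU1 _ hA). Qed.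

Lemma glue_p f i j : glue alpha h f i j (p h) = i.
Proof. by rewrite ffunE /same_circle connect0. Qed.

Lemma glue_q f i j : ~~ same alpha' (p h) (q h) -> glue alpha h f i j (q h) = j.
Proof. by move=> /negPf pq; rewrite ffunE pq /same_circle connect0. Qed.

Lemma compatible_glue f i j : is_state_mono Gam alpha f ->
  compatible alpha h f (glue alpha h f i j).
Proof.
move=> fS; rewrite /compatible fS /=; apply/andP; split; last first.
  apply/forallP=> x; apply/implyP; rewrite -touchedU1 /touched negb_or.
  by case/andP=> /negPf xp /negPf xq; rewrite ffunE xp xq.
apply/state_monoP=> x y xy; rewrite !ffunE.
have csym := same_circle_sym Gam alpha'.
rewrite /same_circle !(same_connect_r csym xy).
case: ifP => // yp; case: ifP => // yq.
have xt : ~~ touched Gam h alpha x.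
  rewrite -touchedU1 /touched /same_circle !(same_connect_r csym xy).
  by rewrite yp yq.
by apply: (state_monoP _ _ fS); rewrite (untouched_connect (toggledU1 Gam hA) xt).
Qed.

Lemma compatibleE f g : compatible alpha h f g ->
  g = glue alpha h f (g (p h)) (g (q h)).
Proof.
case/and3P=> _ /state_monoP gS /forallP gf; apply/ffunP=> x; rewrite ffunE.
case: ifP => [/gS//|xp]; case: ifP => [/gS//|xq].
by have /implyP/(_ _)/eqP := gf x; apply; rewrite -touchedU1 /touched xp xq.
Qed.

Lemma sum_compatible1 (R : nmodType) f (F : mono G n -> R) :
    is_state_mono Gam alpha f -> same alpha' (p h) (q h) ->
  \sum_(g | compatible alpha h f g) F g = \sum_i F (glue alpha h f i i).
Proof.
move=> fS pq; rewrite (reindex_onto (fun i => glue alpha h f i i) (fun g => g (p h))).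
  by apply: eq_bigl => i; rewrite compatible_glue // glue_p eqxx.
move=> g gC; rewrite [RHS](compatibleE gC).
by case/and3P: gC => _ /state_monoP/(_ _ _ pq) <-.
Qed.

Lemma sum_compatible2 (R : nmodType) f (F : mono G n -> R) :
    is_state_mono Gam alpha f -> ~~ same alpha' (p h) (q h) ->
  \sum_(g | compatible alpha h f g) F g =
    \sum_i \sum_j F (glue alpha h f i j).
Proof.
move=> fS pq; rewrite pair_big /=.
rewrite (reindex_onto (fun u : 'I_n * 'I_n => glue alpha h f u.1 u.2)
          (fun g => (g (p h), g (q h)))) => [|g gC].
  apply: eq_bigl => -[i j] /=.
  by rewrite compatible_glue // glue_p glue_q // eqxx.
by rewrite [RHS](compatibleE gC).
Qed.
End Glue.
End StepCoefficients.

(** * Sums of roots of unity *)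

Section RootsOfUnity.
Variables (F : fieldType) (n : nat) (z : F).
Hypothesis z_prim : n.-primitive_root z.

Lemma prim_root_neq0 : z != 0.
Proof.
apply/eqP=> z0; have /eqP := prim_expr_order z_prim.
by rewrite z0 expr0n gtn_eqF ?(prim_order_gt0 z_prim) // eq_sym oner_eq0.
Qed.

(** The ratio is an [n]-th root of unity, and the geometric sum over one different from 1
    vanishes. *)
Lemma sum_unity_root_powers a b :
  \sum_(i < n) (z ^+ a / z ^+ b) ^+ i = (if (a == b %[mod n])%N then n%:R else 0).
Proof.
have zb : z ^+ b != 0 by rewrite expf_neq0 // prim_root_neq0.
rewrite -(eq_prim_root_expr z_prim); case: eqP => [->|ab].
  rewrite divff // (eq_bigr (fun=> 1)) => [|i _]; last by rewrite expr1n.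
  by rewrite sumr_const card_ord.
apply/eqP; have: (z ^+ a / z ^+ b) ^+ n - 1 == 0.
  by rewrite expr_div_n -!exprM !(mulnC _ n) !exprM (prim_expr_order z_prim) !expr1n divr1 subrr.
rewrite subrX1 mulf_eq0 subr_eq0 => /orP[|//].
by move=> /eqP E; case: ab; rewrite -[LHS](divfK zb) E mul1r.
Qed.

Lemma sum_delta_mod a (H : nat -> F) :
    (forall i j, (i == j %[mod n])%N -> H i = H j) -> (0 < n)%N ->
  \sum_(i < n) H i *+ (a == i %[mod n])%N = H a.
Proof.
move=> Hmod n_gt0; have a_lt := ltn_pmod a n_gt0.
rewrite (bigD1 (Ordinal a_lt)) //= modn_mod eqxx mulr1n big1 ?addr0.
  by apply: Hmod; rewrite modn_mod.
move=> i; rewrite -val_eqE /= => ia; rewrite (modn_small (ltn_ord i)).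
by rewrite eq_sym (negPf ia).
Qed.
End RootsOfUnity.

(** * Characters *)

Section Characters.
Variables (G : graph) (Gam : ribbon G) (n : nat).
Variables (F : fieldType) (z s : F).
Hypotheses (z_prim : n.-primitive_root z) (s2 : s ^+ 2 = n%:R) (s_neq0 : s != 0).
Implicit Types (alpha : {set hedge G}) (h : hedge G) (f g e : mono G n).
Implicit Types (phi : bpoint G -> 'I_n).
Local Notation p h := (inl (h, false) : bpoint G).
Local Notation q h := (inl (h, true) : bpoint G).
Local Notation same := (same_circle Gam).

Let n_gt0 : (0 < n)%N. Proof. exact: prim_order_gt0 z_prim. Qed.

Definition lam (a : nat) : F := s * z ^+ (n./2 * a).
(** The weight of a circle of colour [a] carrying exponent [b]. Dividing by [lam a] gives merges,
    splits and one-to-one steps the same eigenvalue [lam a]. *)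
Definition chr (a b : nat) : F := z ^+ (a * b) / lam a.

Lemma lam_neq0 a : lam a != 0.
Proof. by rewrite mulf_neq0 ?expf_neq0 ?(prim_root_neq0 z_prim). Qed.

Lemma lam_sqr a : lam a ^+ 2 = n%:R * z ^+ (a * (2 * n./2)).
Proof. by rewrite exprMn s2 -exprM (mulnC 2) (mulnCA a) mulnA. Qed.

Lemma chr_mod a b c : (b == c %[mod n])%N -> chr a b = chr a c.
Proof.
move=> bc; congr (_ / _); apply/eqP.
by rewrite (eq_prim_root_expr z_prim) -modnMmr (eqP bc) modnMmr.
Qed.

Lemma chrD a b c : lam a * (chr a b * chr a c) = chr a (b + c).
Proof.
by rewrite /chr mulnDr exprD; field; apply: lam_neq0.
Qed.

(** If the colours at [p] and [q] agree, all four ends of the band share them, so either way of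
    joining these ends respects [phi]. *)
Lemma circle_fun_toggle (T : Type) h alpha beta (phi : bpoint G -> T) :
    toggled Gam h alpha beta ->
  circle_fun Gam beta phi -> phi (p h) = phi (q h) -> circle_fun Gam alpha phi.
Proof.
move=> ab phiB phi_pq.
have arcB x y : boundary_arc Gam beta x y -> phi x = phi y.
  by move=> xy; apply/phiB/connect1.
have at_h b : phi (inl (h, b)) = phi (inl (band_end Gam alpha (h, b))).
  have -> : phi (inl (h, b)) = phi (inl (h, ~~ b)) by case: b; rewrite phi_pq.
  apply: arcB; rewrite boundary_arcE; apply/orP; right.
  by rewrite /band_end /= ab eqxx; case: b; case: band_twist.
have arcA x y : boundary_arc Gam alpha x y -> phi x = phi y.
  case: x y => [x|x] [y|y]; rewrite ?boundary_arcE; last first.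
  - by case: x y => [? ?] [? ?] xy; apply: arcB; apply: xy.
  - by case: x y => [? ?] [? ?].
  - by case: x y => [? ?] [? ?].
  case/orP=> /eqP->; first by apply: arcB; rewrite boundary_arcE eqxx.
    have [xh|xh] := eqVneq x.1 h; first by case: x xh => x b /= ->.
    have [xh'|xh'] := eqVneq x.1 (opp h).
      have := at_h (band_end Gam alpha x).2; rewrite -[h](oppK h) -xh'.
      by rewrite -[(_, _)]/(band_end Gam alpha x) band_endK => ->.
    apply: arcB; rewrite boundary_arcE /band_end ab (negPf xh) (negPf xh').
    by rewrite addbF eqxx orbT.
move=> x y /connectP[t]; elim: t x => [|w t IH] x /=; first by move=> _ ->.
by case/andP=> /arcA-> /IH; apply.
Qed.

Definition character alpha phi f : F :=
  \prod_(x | circles Gam alpha x) chr (phi x) (f x).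

Lemma characterE alpha h phi f :
    circle_fun Gam alpha phi -> is_state_mono Gam alpha f ->
  character alpha phi f =
    (if same alpha (p h) (q h) then chr (phi (p h)) (f (p h))
     else chr (phi (p h)) (f (p h)) * chr (phi (q h)) (f (q h))) *
    \prod_(x | circles Gam alpha x && ~~ touched Gam h alpha x)
       chr (phi x) (f x).
Proof.
move=> phiC /state_monoP fC; rewrite /character (big_circles _ h) // => x y xy.
by rewrite (phiC x y) // (fC x y).
Qed.

Lemma edge_character alpha h phi f : h \notin alpha ->
    circle_fun Gam (h |: alpha) phi -> is_state_mono Gam alpha f ->
  \sum_g edge_coef Gam (filtered_structure n s) alpha h f g *
         character (h |: alpha) phi g =
  if phi (p h) == phi (q h) then lam (phi (p h)) * character alpha phi f else 0.
Proof.
move=> hA phiC fS; have tog := toggledU1 Gam hA.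
pose rest := \prod_(x | circles Gam alpha x && ~~ touched Gam h alpha x)
       chr (phi x) (f x).
pose loc g := if same (h |: alpha) (p h) (q h) then chr (phi (p h)) (g (p h))
     else chr (phi (p h)) (g (p h)) * chr (phi (q h)) (g (q h)).
have chiE g : compatible Gam alpha h f g ->
    character (h |: alpha) phi g = loc g * rest.
  case/and3P=> _ gS /forallP gf; rewrite (characterE h phiC gS); congr (_ * _).
  rewrite (big_untouched _ _ tog); apply: eq_bigr => x /andP[_ xt].
  by have /implyP/(_ xt)/eqP-> := gf x.
transitivity (\sum_(g | compatible Gam alpha h f g)
    s ^+ is_eta Gam alpha h *+ admissible Gam alpha h f g * loc g * rest).
  rewrite [RHS]big_mkcond; apply: eq_bigr => g _; rewrite edge_coefE.
  case: ifP => gC; first by rewrite chiE // mulrA.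
  by rewrite /admissible gC mulr0n mul0r.
rewrite -mulr_suml.
have chi_f : phi (p h) = phi (q h) -> character alpha phi f =
    (if same alpha (p h) (q h) then chr (phi (p h)) (f (p h))
     else chr (phi (p h)) (f (p h)) * chr (phi (p h)) (f (q h))) * rest.
  move=> phi_pq; rewrite (characterE h _ fS) ?phi_pq //.
  exact: circle_fun_toggle tog phiC phi_pq.
have := same_circle_toggle tog; rewrite /loc /admissible /is_eta.
case pqA: (same alpha _ _); case pqB: (same (h |: alpha) _ _) => //= _.
(* The case of eta: one exponent survives, and the shift by [n./2] together with [s] produces
   [lam]. *)
- have phi_pq := phiC _ _ pqB; rewrite phi_pq eqxx chi_f // pqA phi_pq mulrA.
  congr (_ * _); rewrite sum_compatible1 //.
  transitivity (\sum_(i < n) s * chr (phi (q h)) i *+ (f (p h) + n./2 == i %[mod n])%N).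
    apply: eq_bigr => i _; rewrite compatible_glue // glue_p /=.
    by rewrite mulrnAl.
  rewrite (@sum_delta_mod F n _ (fun i => s * chr (phi (q h)) i)) //; last first.
    by move=> i j /chr_mod->.
  have := lam_neq0 (phi (q h)); rewrite /chr mulnDr exprD /lam (mulnC _ n./2).
  by move: (z ^+ (n./2 * _)) => u; move: (z ^+ _) => v; rewrite mulf_eq0 negb_or => /andP[s0 u0]; field; rewrite ?s0 ?u0.
(* The case of Delta: modulo [n] the exponent [j] is [c + (n - i)]. What remains is the geometric
   sum in the ratio of the two colours: [n] if they agree, 0 otherwise. The factor [n] is absorbed
   by [lam_sqr]. *)
- rewrite sum_compatible2 ?pqB //; set c := (_ + 2 * n./2)%N.
  transitivity ((\sum_(i < n) \sum_(j < n)
      chr (phi (p h)) i * chr (phi (q h)) j *+ (c + (n - i) == j %[mod n])%N) * rest).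
    congr (_ * _); apply: eq_bigr => i _; apply: eq_bigr => j _.
    rewrite compatible_glue // glue_p glue_q ?pqB //= expr0 mulrnAl mul1r.
    rewrite -[in RHS](eqn_modDl i) addnCA subnKC ?(ltnW (ltn_ord i)) //.
    by rewrite modnDr eq_sym.
  transitivity (z ^+ (phi (q h) * c) / (lam (phi (p h)) * lam (phi (q h))) *
      (\sum_(i < n) (z ^+ phi (p h) / z ^+ phi (q h)) ^+ i) * rest).
    congr (_ * _); rewrite mulr_sumr.
    apply: eq_bigr => i _.
    rewrite (@sum_delta_mod F n _ (fun j => chr (phi (p h)) i * chr (phi (q h)) j)) //; last first.
      by move=> j j' /chr_mod->.
    have z0 m : z ^+ m != 0 by rewrite expf_neq0 ?(prim_root_neq0 z_prim).
    have zV b : z ^+ (b * (n - i)) = (z ^+ (b * i))^-1.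
      apply: (mulIf (z0 (b * i)%N)); rewrite mulVf // -exprD -mulnDr.
      rewrite subnK ?(ltnW (ltn_ord i)) // mulnC exprM.
      by rewrite (prim_expr_order z_prim) expr1n.
    rewrite /chr mulnDr exprD zV expr_div_n -!exprM.
    move: (z ^+ (phi (q h) * i)) (z0 (phi (q h) * i)%N) => u u0.
    move: (lam (phi (p h))) (lam_neq0 (phi (p h))) => a a0.
    move: (lam (phi (q h))) (lam_neq0 (phi (q h))) => b b0.
    move: (z ^+ _) (z ^+ _) => v w.
    by field; rewrite u0 a0 b0.
  rewrite (sum_unity_root_powers z_prim) !modn_small //.
  have [phi_pq|phi_ne] := eqVneq (phi (p h)) (phi (q h)); last first.
    by move: phi_ne; rewrite -val_eqE /= => /negPf->; rewrite mulr0 mul0r.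
  rewrite phi_pq eqxx chi_f // pqA phi_pq mulrA; congr (_ * _).
  have l0 := lam_neq0 (phi (q h)).
  rewrite -expr2 lam_sqr /chr /c mulnDr exprD.
  have nz : n%:R * z ^+ (phi (q h) * (2 * n./2)) != 0 by rewrite -lam_sqr expf_neq0.
  move: nz; rewrite mulf_eq0 negb_or => /andP[].
  move: (z ^+ _) (z ^+ _) (lam _) l0 => u v l l0.
  by move: (n%:R : F) => N N0 v0; field; rewrite l0 N0 v0.
(* The case of mu: a single exponent survives, and [chrD] splits its weight. *)
have phi_pq := phiC _ _ pqB; rewrite phi_pq eqxx chi_f // pqA phi_pq mulrA.
congr (_ * _); rewrite sum_compatible1 // chrD.
transitivity (\sum_(i < n) chr (phi (q h)) i *+ (f (p h) + f (q h) == i %[mod n])%N).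
  apply: eq_bigr => i _; rewrite compatible_glue // glue_p /=.
  by rewrite expr0 mulrnAl mul1r.
by rewrite (@sum_delta_mod F n _ (fun i => chr (phi (q h)) i)) // => i j /chr_mod->.
Qed.
End Characters.

(** * Exchanging two steps *)

Section TwoSteps.
Variables (G : graph) (Gam : ribbon G) (n : nat).
Implicit Types (alpha : {set hedge G}) (h : hedge G) (f g e : mono G n).
Local Notation p h := (inl (h, false) : bpoint G).
Local Notation q h := (inl (h, true) : bpoint G).

Section OverField.
Variables (F : fieldType) (z s : F).
Hypotheses (z_prim : n.-primitive_root z) (s2 : s ^+ 2 = n%:R) (s_neq0 : s != 0).
Let n_gt0 : (0 < n)%N. Proof. exact: prim_order_gt0 z_prim. Qed.
Local Notation coef := (edge_coef Gam (filtered_structure n s)).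
Local Notation char := (character Gam z s).
Local Notation lm := (@lam n F z s).
Local Notation two_step alpha h1 h2 f e :=
  (\sum_g coef alpha h1 f g * coef (h1 |: alpha) h2 g e).

Lemma edge_coef_mono alpha h f g : coef alpha h f g != 0 ->
  is_state_mono Gam alpha f && is_state_mono Gam (h |: alpha) g.
Proof. by rewrite /edge_coef; case: ifP => [/and3P[-> ->]|]; rewrite ?eqxx. Qed.

(** The value is symmetric in [h1] and [h2]. If [phi] agrees on the two sides of [h2], it also
    colours the circles of the intermediate state, so [edge_character] applies a second time. *)
Lemma two_step_character alpha h1 h2 phi f :
    h1 \notin alpha -> h2 \notin alpha -> h1 != h2 ->
    circle_fun Gam (h1 |: (h2 |: alpha)) phi -> is_state_mono Gam alpha f ->
  \sum_e two_step alpha h1 h2 f e * char (h1 |: (h2 |: alpha)) phi e =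
  (if (phi (p h1) == phi (q h1)) && (phi (p h2) == phi (q h2)) then
     lm (phi (p h1)) * lm (phi (p h2)) * char alpha phi f
   else 0).
Proof.
move=> h1A h2A h12 phiC fS; rewrite setUCA in phiC *.
have h2A1 : h2 \notin h1 |: alpha by rewrite !inE negb_or eq_sym h12.
transitivity (\sum_g coef alpha h1 f g * \sum_e coef (h1 |: alpha) h2 g e *
    char (h2 |: (h1 |: alpha)) phi e).
  rewrite (eq_bigr _ (fun e _ => mulr_suml _ _ _ _)) exchange_big /=.
  apply: eq_bigr => g _; rewrite mulr_sumr; apply: eq_bigr => e _.
  by rewrite mulrA.
transitivity (\sum_g coef alpha h1 f g *
    (if phi (p h2) == phi (q h2) then
       lm (phi (p h2)) * char (h1 |: alpha) phi g else 0)).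
  apply: eq_bigr => g _; have [->|/edge_coef_mono/andP[_ gS]] :=
    eqVneq (coef alpha h1 f g) 0; first by rewrite !mul0r.
  by rewrite edge_character.
rewrite andbC; have [phi2|_] := eqVneq (phi (p h2)) (phi (q h2)); last first.
  by rewrite big1 // => g _; rewrite mulr0.
rewrite (eq_bigr _ (fun g _ => mulrCA _ _ _)) -mulr_sumr edge_character //.
  by case: ifP; rewrite ?mulr0 // mulrCA mulrA.
exact: circle_fun_toggle (toggledU1 Gam h2A1) phiC phi2.
Qed.

(** Fourier inversion: pairing with the inverse weights of [e0] and summing over colourings isolates
    [u e0], up to a power of [n], which is nonzero because [n] is the square of [s]. *)
Lemma character_inj alpha (u : mono G n -> F) :
    (forall e, u e != 0 -> is_state_mono Gam alpha e) ->
    (forall phi, circle_fun Gam alpha phi ->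
       \sum_e u e * char alpha phi e = 0) ->
  forall e, u e = 0.
Proof.
move=> uS u0 e0; apply/eqP; apply/negP=> /negP ue0; have e0S := uS _ ue0.
have csym := same_circle_sym Gam alpha.
have z_neq0 m : z ^+ m != 0 by rewrite expf_neq0 ?(prim_root_neq0 z_prim).
(* Colourings range over all functions on points and are read off at the roots. The sum over [psi]
   then distributes over a product over all points, where each point that is not a root contributes
   a factor [n]. *)
pose phi (psi : {ffun bpoint G -> 'I_n}) x :=
  psi (fingraph.root (boundary_arc Gam alpha) x).
have phiC psi : circle_fun Gam alpha (phi psi).
  by move=> x y xy; congr (psi _); apply/(fingraph.rootP csym).
pose c psi := \prod_(x | circles Gam alpha x)
  (lm (phi psi x) / z ^+ (phi psi x * e0 x)).
pose K x (a : 'I_n) e := if circles Gam alpha x then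
  (z ^+ e x / z ^+ e0 x) ^+ a else 1.
have cE psi e : c psi * char alpha (phi psi) e =
    \prod_x K x (psi x) e.
  rewrite -big_split /= big_mkcond /=; apply: eq_bigr => x _; rewrite /K.
  case: ifP => // xr; have -> : phi psi x = psi x by congr (psi _); apply/eqP.
  rewrite /chr expr_div_n -!exprM !(mulnC (psi x)).
  have := lam_neq0 z_prim s_neq0 (psi x); move: (lam _ _ _) => l l0.
  by move: (z ^+ _) (z ^+ _) (z_neq0 (e0 x * psi x)%N) => v w v0; field; rewrite l0 v0.
have : \sum_psi c psi * \sum_e u e * char alpha (phi psi) e = 0.
  by rewrite big1 // => psi _; rewrite u0 ?mulr0.
have -> : \sum_psi c psi * \sum_e u e * char alpha (phi psi) e =
    \sum_e u e * \prod_x \sum_a K x a e.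
  rewrite (eq_bigr _ (fun psi _ => mulr_sumr _ _ _ _)) exchange_big /=.
  apply: eq_bigr => e _; rewrite bigA_distr_bigA mulr_sumr /=.
  by apply: eq_bigr => psi _; rewrite mulrCA cE.
have sumK x e : \sum_a K x a e =
    if circles Gam alpha x && (e x != e0 x) then 0 else n%:R.
  rewrite /K; case: (circles Gam alpha x) => /=; last by rewrite sumr_const card_ord.
  rewrite (sum_unity_root_powers z_prim) !modn_small //.
  by rewrite -val_eqE; case: eqP.
have n_neq0 : n%:R != 0 :> F by rewrite -s2 expf_neq0.
rewrite (bigD1 e0) //= [X in _ + X]big1 ?addr0 => [|e ee0]; last first.
  have [->|/uS eS] := eqVneq (u e) 0; first by rewrite mul0r.
  have [x xr xe] : exists2 x, circles Gam alpha x & e x != e0 x.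
    apply: contrapT => nx; case/eqP: ee0; apply/ffunP=> y.
    have rt := connect_root (boundary_arc Gam alpha) y.
    rewrite (state_monoP _ _ _ eS _ _ rt) (state_monoP _ _ _ e0S _ _ rt).
    apply/eqP/negPn/negP => ne; apply: nx.
    by exists (fingraph.root (boundary_arc Gam alpha) y); rewrite // /circles roots_root.
  by rewrite (bigD1 x) //= sumK xr xe mul0r mulr0.
move/eqP; rewrite mulf_eq0 (negPf ue0) prodf_seq_eq0 => /hasP[x _ /=].
by rewrite sumK eqxx andbF (negPf n_neq0).
Qed.

Lemma two_step_mono alpha h1 h2 f e : two_step alpha h1 h2 f e != 0 ->
  is_state_mono Gam alpha f && is_state_mono Gam (h2 |: (h1 |: alpha)) e.
Proof.
apply: contraNT => nfe; apply/eqP/big1 => g _; apply/eqP; apply: contraNT nfe.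
rewrite mulf_eq0 negb_or => /andP[/edge_coef_mono/andP[-> _]].
by move=> /edge_coef_mono/andP[_ ->].
Qed.

Lemma two_step_swap_field alpha h1 h2 f e :
    h1 \notin alpha -> h2 \notin alpha -> h1 != h2 ->
  two_step alpha h1 h2 f e = two_step alpha h2 h1 f e.
Proof.
move=> h1A h2A h12; apply/eqP; rewrite -subr_eq0; apply/eqP; move: e.
apply: (character_inj (alpha := h1 |: (h2 |: alpha))) => [e|phi phiC].
  apply: contraNT => nfe.
  have /eqP-> : two_step alpha h1 h2 f e == 0.
    by apply: contraNT nfe => /two_step_mono/andP[_]; rewrite setUCA.
  have /eqP-> : two_step alpha h2 h1 f e == 0.
    by apply: contraNT nfe => /two_step_mono/andP[_].
  by rewrite subrr.
have [fS|nfS] := boolP (is_state_mono Gam alpha f); last first.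
  apply: big1 => e _; have n0 h h' : two_step alpha h h' f e = 0.
    by apply/eqP; apply: contraNT nfS => /two_step_mono/andP[].
  by rewrite !n0 subrr mul0r.
rewrite (eq_bigr _ (fun e _ => mulrBl _ _ _)) sumrB two_step_character //.
rewrite setUCA in phiC *; rewrite two_step_character 1?eq_sym //.
by rewrite andbC (mulrC (lm (phi (p h2)))) subrr.
Qed.
End OverField.

(** The field identity holds in [algC] for both square roots of [n]. If the two powers have equal
    parity, the leftover square root cancels. Otherwise one side changes sign with the root and the
    other does not, so both counts are zero. *)
Lemma two_step_count_swap alpha h1 h2 f e : (0 < n)%N ->
    h1 \notin alpha -> h2 \notin alpha -> h1 != h2 ->
  let N12 := two_step_count Gam alpha h1 h2 f e in
  let N21 := two_step_count Gam alpha h2 h1 f e in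
  let e12 := two_step_eta Gam alpha h1 h2 in
  let e21 := two_step_eta Gam alpha h2 h1 in
  (n ^ e12./2 * N12 = n ^ e21./2 * N21)%N /\
  (odd e12 = odd e21 \/ N12 = 0%N /\ N21 = 0%N).
Proof.
move=> n_gt0 h1A h2A h12 N12 N21 e12 e21.
have [z z_prim] := C_prim_root_exists n_gt0.
pose r : algC := sqrtC n%:R.
have n_neq0 : n%:R != 0 :> algC by rewrite pnatr_eq0 -lt0n.
have r2 : r ^+ 2 = n%:R by rewrite sqrtCK.
have r_neq0 : r != 0 by rewrite sqrtC_eq0.
have expE (s : algC) m : s ^+ 2 = n%:R -> s ^+ m = s ^+ odd m * (n ^ m./2)%:R.
  by move=> s2; rewrite natrX -s2 -exprM -exprD mul2n odd_double_half.
have swap (s : algC) : s ^+ 2 = n%:R ->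
    s ^+ odd e12 * (n ^ e12./2 * N12)%:R = s ^+ odd e21 * (n ^ e21./2 * N21)%:R.
  move=> s2; have s_neq0 : s != 0.
    by apply: contraNneq n_neq0 => s0; rewrite -s2 s0 expr0n.
  have := two_step_swap_field z_prim s2 s_neq0 f e h1A h2A h12.
  rewrite !two_step_coefE -/N12 -/N21 -/e12 -/e21 (expE _ e12 s2) (expE _ e21 s2).
  by rewrite -[_ *+ N12]mulr_natr -[_ *+ N21]mulr_natr !natrM !mulrA.
have zero (a b : nat) : r * a%:R = b%:R -> - r * a%:R = b%:R -> a = 0%N /\ b = 0%N.
  move=> ra; rewrite mulNr ra => /eqP; rewrite eqNr pnatr_eq0 => /eqP b0.
  move/eqP: ra; rewrite b0 mulf_eq0 (negPf r_neq0) pnatr_eq0 => /eqP a0.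
  by split.
have n0 m N : (n ^ m * N = 0)%N -> N = 0%N.
  by move/eqP; rewrite muln_eq0 expn_eq0 gtn_eqF // => /eqP.
have := swap _ r2; have := swap (- r); rewrite sqrrN => /(_ r2).
case: (odd e12) (odd e21) => -[]; rewrite ?expr0 ?expr1 ?mul1r.
- by move=> _ /(mulfI r_neq0)/eqP; rewrite eqr_nat => /eqP ->; split=> //; left.
- by move=> Em Ep; have [/[dup] /n0 -> -> /[dup] /n0 -> ->] := zero _ _ Ep Em; split=> //; right.
- move=> Em Ep; have [/[dup] /n0 -> -> /[dup] /n0 -> ->] := zero _ _ (esym Ep) (esym Em).
  by split=> //; right.
- by move=> _ /eqP; rewrite eqr_nat => /eqP ->; split=> //; left.
Qed.

Lemma two_step_swap (k : comPzRingType) (s : k) alpha h1 h2 f e :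
    (0 < n)%N -> s ^+ 2 = n%:R ->
    h1 \notin alpha -> h2 \notin alpha -> h1 != h2 ->
  \sum_g edge_coef Gam (filtered_structure n s) alpha h1 f g *
         edge_coef Gam (filtered_structure n s) (h1 |: alpha) h2 g e =
  \sum_g edge_coef Gam (filtered_structure n s) alpha h2 f g *
         edge_coef Gam (filtered_structure n s) (h2 |: alpha) h1 g e.
Proof.
move=> n_gt0 s2 h1A h2A h12; rewrite !two_step_coefE.
have [Nn [odd_eq|[-> ->]]] := two_step_count_swap f e n_gt0 h1A h2A h12; last first.
  by rewrite !mulr0n.
have expE m N : s ^+ m *+ N = s ^+ odd m *+ (n ^ m./2 * N).
  rewrite -[in LHS](odd_double_half m) exprD -mul2n exprM s2 -natrX.
  by rewrite mulr_natr -mulrnA.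
by rewrite expE [RHS]expE odd_eq Nn.
Qed.
End TwoSteps.

(** * Path independence *)

Section PathIndependence.
Variables (G : graph) (Gam : ribbon G) (n : nat) (k : comPzRingType) (s : k).
Hypotheses (n_gt0 : (0 < n)%N) (s2 : s ^+ 2 = n%:R).
Implicit Types (alpha : {set hedge G}) (h : hedge G) (u : tensors G k n).
Local Notation T := (filtered_structure n s).

Lemma edge_map_swap alpha h1 h2 u :
    h1 \notin alpha -> h2 \notin alpha -> h1 != h2 ->
  edge_map Gam T (h1 |: alpha) h2 (edge_map Gam T alpha h1 u) =
  edge_map Gam T (h2 |: alpha) h1 (edge_map Gam T alpha h2 u).
Proof.
have edge_edgeE h h' e :
    edge_map Gam T (h |: alpha) h' (edge_map Gam T alpha h u) e =
    \sum_f (\sum_g edge_coef Gam T alpha h f g *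
                   edge_coef Gam T (h |: alpha) h' g e) * u f.
  rewrite ffunE; under eq_bigr do rewrite ffunE scaler_sumr.
  rewrite exchange_big /=; apply: eq_bigr => f _; rewrite mulr_suml.
  by apply: eq_bigr => g _; rewrite scalerA [X in X *: _]mulrC.
move=> h1A h2A h12; apply/ffunP=> e; rewrite !edge_edgeE.
by apply: eq_bigr => f _; rewrite two_step_swap.
Qed.

Definition fresh alpha (t : seq (hedge G)) :=
  uniq t && all (fun h => h \notin alpha) t.

Lemma fresh_cons alpha h t :
  fresh alpha (h :: t) = (h \notin alpha) && fresh (h |: alpha) t.
Proof.
have -> : fresh (h |: alpha) t =
    uniq t && ((h \notin t) && all (fun h => h \notin alpha) t).
  rewrite /fresh -has_pred1 -all_predC -all_predI; congr (_ && _).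
  by apply: eq_all => x; rewrite /= !inE negb_or.
by rewrite /fresh /=; case: (h \in alpha); case: (h \in t); case: (uniq t); rewrite ?andbF.
Qed.

Lemma fresh_perm alpha t t' : perm_eq t t' -> fresh alpha t = fresh alpha t'.
Proof. by move=> tt'; rewrite /fresh (perm_uniq tt') (perm_all _ tt'). Qed.

Lemma path_map_front alpha t1 h t2 u : fresh alpha (t1 ++ h :: t2) ->
  path_map Gam T alpha (t1 ++ h :: t2) u = path_map Gam T alpha (h :: t1 ++ t2) u.
Proof.
elim: t1 alpha u => //= h1 t1 IH alpha u; rewrite fresh_cons => /andP[h1A ft].
have : fresh (h1 |: alpha) (h :: t1 ++ t2).
  by rewrite -(fresh_perm _ (permEl (perm_catCA t1 [:: h] t2))).
rewrite fresh_cons !inE negb_or => /andP[/andP[hh1 hA] _].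
by rewrite IH //= setUCA edge_map_swap // eq_sym.
Qed.

Lemma path_map_perm alpha t t' u : perm_eq t t' -> fresh alpha t ->
  path_map Gam T alpha t u = path_map Gam T alpha t' u.
Proof.
elim: t t' alpha u => [|h t IH] t' alpha u tt' ft.
  by move: tt'; rewrite perm_sym => /perm_nilP->.
have ht' : h \in t' by rewrite -(perm_mem tt') mem_head.
case/splitPr: ht' tt' => t1 t2 tt'.
rewrite path_map_front -?(fresh_perm _ tt') //=.
move: ft; rewrite fresh_cons => /andP[_]; apply: IH.
by rewrite -(perm_cons h) (perm_trans tt') // perm_catC /= perm_cons perm_catC.
Qed.

Lemma path_map_cat alpha t t' u : path_map Gam T alpha (t ++ t') u =
  path_map Gam T ([set h in t] :|: alpha) t' (path_map Gam T alpha t u).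
Proof.
elim: t alpha u => [|h t IH] alpha u /=.
  by congr (path_map _ _ _ _ _); apply/setP=> x; rewrite !inE.
by rewrite IH; congr (path_map _ _ _ _ _); apply/setP=> x; rewrite !inE orbCA orbA.
Qed.

Section Delta.
Variable ch : choices G.
Implicit Types (nu : {set vertex G}) (v w : vertex G) (c : chains G k n).

Lemma alpha_of_steps nu mu w :
  [set h in steps ch mu w] :|: alpha_of nu = alpha_of (w |: nu).
Proof.
by apply/setP=> h; rewrite !inE (perm_mem (stepsP ch mu w)) mem_enum inE.
Qed.

Lemma steps_fresh nu mu v : v \notin nu -> fresh (alpha_of nu) (steps ch mu v).
Proof.
move=> vnu; rewrite (fresh_perm _ (stepsP ch mu v)) /fresh enum_uniq /=.
by apply/allP=> h; rewrite mem_enum !inE => /eqP->.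
Qed.

(** Both composites are paths from [alpha_of nu] through all half-edges at [v] and [w], listed in
    different orders. *)
Lemma two_vertex_paths nu v w : v \notin nu -> w \notin nu -> v != w ->
  forall u, path_map Gam T (alpha_of (w |: nu)) (steps ch (w |: nu) v)
              (path_map Gam T (alpha_of nu) (steps ch nu w) u) =
            path_map Gam T (alpha_of (v |: nu)) (steps ch (v |: nu) w)
              (path_map Gam T (alpha_of nu) (steps ch nu v) u).
Proof.
move=> vnu wnu vw u; rewrite -(alpha_of_steps nu nu w) -path_map_cat.
rewrite -(alpha_of_steps nu nu v) -path_map_cat.
have sperm mu mu' x : perm_eq (steps ch mu x) (steps ch mu' x).
  by rewrite (perm_trans (stepsP ch mu x)) // perm_sym stepsP.
apply: path_map_perm.
  by rewrite perm_catC perm_cat.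
have fw := steps_fresh nu wnu; have fv := steps_fresh (w |: nu) vnu.
case/andP: (fw) => uw aw; case/andP: (fv) => uv av.
rewrite /fresh cat_uniq all_cat uw uv aw av !andbT /=; apply/hasPn=> h.
rewrite !(perm_mem (stepsP ch _ _)) !mem_enum !inE => /eqP->.
by [].
Qed.

Lemma sign_exponentU1 nu v w : w \notin nu ->
  sign_exponent ch (w |: nu) v =
    ((vorder ch w < vorder ch v) + sign_exponent ch nu v)%N.
Proof.
move=> wnu; rewrite /sign_exponent (cardsD1 w) !inE eqxx /=; congr (_ + _)%N.
apply: eq_card => x; rewrite !inE; case: eqVneq => //= ->.
by rewrite (negPf wnu).
Qed.

Lemma deltaE (T' : structure k n) c nu : delta Gam T' ch c nu = \sum_(v in nu)
  (-1) ^+ sign_exponent ch (nu :\ v) v *: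
    path_map Gam T' (alpha_of (nu :\ v)) (steps ch (nu :\ v) v) (c (nu :\ v)).
Proof. by rewrite ffunE. Qed.

Lemma delta_sqr c : delta Gam T ch (delta Gam T ch c) = 0.
Proof.
apply/ffunP=> nu; rewrite deltaE [RHS]ffunE.
pose t v w := (-1) ^+ sign_exponent ch (nu :\ v) v *:
  ((-1) ^+ sign_exponent ch (nu :\ v :\ w) w *:
   path_map Gam T (alpha_of (nu :\ v)) (steps ch (nu :\ v) v)
    (path_map Gam T (alpha_of (nu :\ v :\ w)) (steps ch (nu :\ v :\ w) w)
       (c (nu :\ v :\ w)))).
transitivity (\sum_(v in nu) \sum_(w in nu :\ v) t v w).
  apply: eq_bigr => v _; rewrite deltaE.
  pose P : {linear _ -> _} := linear_of (path_map_linear Gam T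
    (alpha_of (nu :\ v)) (steps ch (nu :\ v) v)).
  rewrite -[path_map _ _ _ _ _]/(P _) linear_sum scaler_sumr.
  by apply: eq_bigr => w _; rewrite /= -[path_map _ _ _ _ (_ *: _)]/(P _) linearZ.
have t_swap v w : v \in nu -> w \in nu -> v != w -> t w v = - t v w.
  move=> vnu wnu vw; rewrite /t.
  have muE : nu :\ w :\ v = nu :\ v :\ w by rewrite !setDDl setUC.
  rewrite muE; set mu := nu :\ v :\ w.
  have vmu : v \notin mu by rewrite !inE eqxx andbF.
  have wmu : w \notin mu by rewrite !inE eqxx.
  have vE : nu :\ v = w |: mu by rewrite setD1K // !inE eq_sym vw.
  have wE : nu :\ w = v |: mu.
    by rewrite /mu -muE setD1K // !inE vw.
  rewrite vE wE two_vertex_paths 1?eq_sym // !scalerA -scaleNr; congr (_ *: _).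
  (* The two total exponents differ only by the comparison of [v] with [w], which holds in exactly
     one direction; hence the opposite signs. *)
  rewrite !sign_exponentU1 // !exprD.
  have : vorder ch v != vorder ch w by rewrite (inj_eq (@vorder_inj _ ch)).
  by case: ltngtP => // _ _; rewrite !(expr0, expr1, mul1r, mulN1r, mulNr, opprK) mulrC.
have sumE : \sum_(v in nu) \sum_(w in nu :\ v) t v w =
    \sum_(x | [&& x.1 \in nu, x.2 \in nu & x.1 != x.2]) t x.1 x.2.
  rewrite pair_big_dep; apply: eq_bigl => -[v w]; rewrite !inE /=.
  by rewrite (eq_sym w); case: (v == w); case: (w \in nu).
rewrite sumE (bigID (fun x => vorder ch x.1 < vorder ch x.2)%N) /= addrC.
(* Exchanging the two vertices matches the decreasing pairs with the increasing ones, and matched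
   terms cancel. *)
pose sw (x : vertex G * vertex G) := (x.2, x.1).
have swK : involutive sw by case.
rewrite (reindex_inj (inv_inj swK)) /= -[RHS](addNr (\sum_(x | [&& x.1 \in nu,
  x.2 \in nu & x.1 != x.2] && (vorder ch x.1 < vorder ch x.2)%N) t x.1 x.2)).
congr (_ + _); rewrite -sumrN; apply: eq_big => -[v w] /=.
  rewrite (eq_sym w) -leqNgt leq_eqVlt (inj_eq (@vorder_inj _ ch)).
  by case: (v == w); case: (v \in nu); case: (w \in nu).
by case/andP=> /and3P[wnu vnu wv] _; rewrite t_swap // eq_sym.
Qed.
End Delta.
End PathIndependence.

(** * Degrees *)

Section Degrees.
Variables (G : graph) (Gam : ribbon G) (n : nat) (k : comPzRingType) (s : k).
Implicit Types (alpha : {set hedge G}) (h : hedge G) (u : tensors G k n).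
Implicit Types (f g : mono G n) (j : int).
Local Notation That := (filtered_structure n s).
Local Notation Tn := (bigraded_structure n s).
Local Notation p h := (inl (h, false) : bpoint G).
Local Notation q h := (inl (h, true) : bpoint G).
Local Notation same := (same_circle Gam).
Local Notation deg := (state_degree Gam).
Local Notation coef_hat := (edge_coef Gam That).
Local Notation coef_n := (edge_coef Gam Tn).

(* The exponents compared by the matrix entry of a step: those of the
   monomials before and after, the shift by [2 * n./2] or [n./2] included. *)
Definition exponent_in alpha h f : nat :=
  if ~~ same alpha (p h) (q h) then (f (p h) + f (q h))%N
  else if ~~ same (h |: alpha) (p h) (q h) then (f (p h) + 2 * n./2)%N
  else (f (p h) + n./2)%N.

Definition exponent_out alpha h g : nat :=
  if same alpha (p h) (q h) && ~~ same (h |: alpha) (p h) (q h) then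
    (g (p h) + g (q h))%N
  else g (p h).

Lemma edge_coef_hatE alpha h f g : coef_hat alpha h f g =
  s ^+ is_eta Gam alpha h *+ (compatible Gam alpha h f g &&
    (exponent_in alpha h f == exponent_out alpha h g %[mod n])%N).
Proof.
rewrite edge_coefE /admissible /exponent_in /exponent_out.
by case: (same alpha _ _); case: (same (h |: alpha) _ _) => //=; rewrite eq_sym.
Qed.

Lemma edge_coef_nE alpha h f g : coef_n alpha h f g =
  s ^+ is_eta Gam alpha h *+ (compatible Gam alpha h f g &&
    (exponent_in alpha h f == exponent_out alpha h g)).
Proof.
rewrite /edge_coef /is_eta /exponent_in /exponent_out.
have -> : compatible Gam alpha h f g = [&& is_state_mono Gam alpha f,
  is_state_mono Gam (h |: alpha) g & [forall x, ~~ same alpha (p h) x &&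
    ~~ same alpha (q h) x ==> (g x == f x)]].
  by congr [&& _, _ & _]; apply: eq_forallb => x; rewrite negb_or.
case: ifP => // _ /=.
by case: (same alpha _ _); case: (same (h |: alpha) _ _) => //=; rewrite eq_sym.
Qed.

(** Otherwise the target exponent would be larger by at least [n]. For mu and eta it is less than
    [n]. For Delta it is at most [2 * n - 2], while the source exponent is at least [2 * n./2],
    hence at least [n - 1]. *)
Lemma exponent_le alpha h f g :
  (exponent_in alpha h f == exponent_out alpha h g %[mod n])%N ->
  (exponent_out alpha h g <= exponent_in alpha h f)%N.
Proof.
move=> io; rewrite leqNgt; apply/negP=> lt_io.
have [d dE] : exists d, exponent_out alpha h g = (exponent_in alpha h f + d.+1 * n)%N.
  have := io; rewrite eq_sym eqn_mod_dvd 1?ltnW // => /dvdnP[[|d] dE].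
    by move: lt_io; rewrite -subn_gt0 dE.
  by exists d; rewrite -dE subnKC // ltnW.
have := ltn_ord (g (p h)); have := ltn_ord (g (q h)).
move: dE; rewrite /exponent_in /exponent_out mulSn; set dn := (d * n)%N.
case: (same alpha _ _); case: (same (h |: alpha) _ _) => /=; lia.
Qed.

(** The new half-twist and the change in the number of circles together add 0, 2 or 1 times [n./2]
    for mu, Delta and eta, which is the shift included in [exponent_in]. *)
Lemma degree_step alpha h f g : h \notin alpha -> compatible Gam alpha h f g ->
  deg (h |: alpha) g =
    deg alpha f + (exponent_in alpha h f)%:Z - (exponent_out alpha h g)%:Z.
Proof.
move=> hA /and3P[/state_monoP fS /state_monoP gS /forallP gf].
have tog := toggledU1 Gam hA.
pose w (f : mono G n) x : int := n./2%:Z - (f x : nat)%:Z.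
have wC a (e : mono G n) : circle_fun Gam a e -> circle_fun Gam a (w e).
  by move=> eS x y xy; rewrite /w (eS x y).
have degE a (e : mono G n) : circle_fun Gam a e -> deg a e =
    (n./2 * #|a|)%:Z + ((if same a (p h) (q h) then w e (p h)
       else w e (p h) + w e (q h)) +
    \sum_(x | circles Gam a x && ~~ touched Gam h a x) w e x).
  by move=> eS; rewrite /state_degree -(big_circles _ h (wC _ _ eS)).
rewrite (degE _ _ fS) (degE _ _ gS) cardsU1 hA (big_untouched _ _ tog).
rewrite (eq_bigr (w f)) => [|x /andP[_ xt]]; last first.
  by rewrite /w; have /implyP/(_ xt)/eqP-> := gf x.
set rest := \sum_(x | _) _; rewrite /exponent_in /exponent_out /w mulnDr muln1.
have := same_circle_toggle tog.
by case: (same alpha _ _); case: (same (h |: alpha) _ _) => //= _; lia.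
Qed.

Definition tsupp (P : pred (mono G n)) u := forall f, u f != 0 -> P f.
Definition deg_ge alpha j : pred (mono G n) :=
  fun f => is_state_mono Gam alpha f && (j <= deg alpha f).
Definition deg_eq alpha j : pred (mono G n) :=
  fun f => is_state_mono Gam alpha f && (deg alpha f == j).

Lemma tsuppD P u v : tsupp P u -> tsupp P v -> tsupp P (u + v).
Proof.
move=> uP vP f; rewrite ffunE; have [u0|/uP//] := eqVneq (u f) 0.
by rewrite u0 add0r => /vP.
Qed.

Lemma sum_neq0 (R : nmodType) (I : finType) (Q : pred I) (E : I -> R) :
  \sum_(i | Q i) E i != 0 -> exists2 i, Q i & E i != 0.
Proof.
move=> E0; apply: contrapT => nE; case/eqP: E0; apply: big1 => i Qi.
by apply/eqP/negPn/negP=> Ei; apply: nE; exists i.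
Qed.

Lemma scale_neq0 (a b : k) : a *: (b : k^o) != 0 -> a != 0 /\ b != 0.
Proof.
move=> ab; split; apply: contraNneq ab => ->; first by rewrite scale0r.
by rewrite scaler0.
Qed.

Lemma edge_hat_ge alpha h j u : h \notin alpha -> tsupp (deg_ge alpha j) u ->
  tsupp (deg_ge (h |: alpha) j) (edge_map Gam That alpha h u).
Proof.
move=> hA uP g; rewrite ffunE => /sum_neq0[f _ /scale_neq0[cfg /uP/andP[_ fj]]].
move: cfg; rewrite edge_coef_hatE; case: andP => [[fg io] _|]; last by rewrite eqxx.
have /and3P[_ gS _] := fg; rewrite /deg_ge gS (degree_step hA fg).
by have := exponent_le io; lia.
Qed.

Lemma edge_n_eq alpha h j u : h \notin alpha -> tsupp (deg_eq alpha j) u ->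
  tsupp (deg_eq (h |: alpha) j) (edge_map Gam Tn alpha h u).
Proof.
move=> hA uP g; rewrite ffunE => /sum_neq0[f _ /scale_neq0[cfg /uP/andP[_ fj]]].
move: cfg; rewrite edge_coef_nE; case: andP => [[fg /eqP io] _|]; last by rewrite eqxx.
have /and3P[_ gS _] := fg; rewrite /deg_eq gS (degree_step hA fg) io.
by move/eqP: fj; lia.
Qed.

(** The two matrices differ only where the exponents are congruent but not equal; there the exponent
    drops strictly, so the degree rises. *)
Lemma edge_diff alpha h j u : h \notin alpha -> tsupp (deg_eq alpha j) u ->
  tsupp (deg_ge (h |: alpha) (j + 1))
    (edge_map Gam That alpha h u - edge_map Gam Tn alpha h u).
Proof.
move=> hA uP g; rewrite !ffunE -sumrB => /sum_neq0[f _].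
rewrite -scalerBl => /scale_neq0[cfg /uP/andP[_ /eqP fj]].
move: cfg; rewrite edge_coef_nE edge_coef_hatE.
case: (boolP (compatible _ _ _ _ _)) => [fg|_]; last by rewrite subrr eqxx.
have /and3P[_ gS _] := fg; rewrite /deg_ge gS (degree_step hA fg) fj.
have [->|io] := eqVneq (exponent_in alpha h f) (exponent_out alpha h g).
  by rewrite eqxx subrr eqxx.
have [/exponent_le|_] :=
  boolP (exponent_in alpha h f == exponent_out alpha h g %[mod n])%N; last by rewrite subrr eqxx.
by move=> io' _; move/eqP: io; lia.
Qed.

Lemma path_hat_ge alpha t j u : fresh alpha t -> tsupp (deg_ge alpha j) u ->
  tsupp (deg_ge ([set h in t] :|: alpha) j) (path_map Gam That alpha t u).
Proof.
elim: t alpha u => [|h t IH] alpha u /=.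
  by rewrite (_ : [set h in [::]] = set0) ?set0U //; apply/setP=> x; rewrite !inE.
rewrite fresh_cons => /andP[hA ft] uP; rewrite set_cons -setUA setUCA.
by apply: IH => //; apply: edge_hat_ge.
Qed.

Lemma path_n_eq alpha t j u : fresh alpha t -> tsupp (deg_eq alpha j) u ->
  tsupp (deg_eq ([set h in t] :|: alpha) j) (path_map Gam Tn alpha t u).
Proof.
elim: t alpha u => [|h t IH] alpha u /=.
  by rewrite (_ : [set h in [::]] = set0) ?set0U //; apply/setP=> x; rewrite !inE.
rewrite fresh_cons => /andP[hA ft] uP; rewrite set_cons -setUA setUCA.
by apply: IH => //; apply: edge_n_eq.
Qed.

Lemma path_diff alpha t j u : fresh alpha t -> tsupp (deg_eq alpha j) u ->
  tsupp (deg_ge ([set h in t] :|: alpha) (j + 1))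
    (path_map Gam That alpha t u - path_map Gam Tn alpha t u).
Proof.
elim: t alpha u => [|h t IH] alpha u /=.
  by move=> _ _ f; rewrite subrr ffunE eqxx.
rewrite fresh_cons => /andP[hA ft] uP; rewrite set_cons -setUA setUCA.
set u1 := edge_map _ That _ _ _; set u2 := edge_map _ Tn _ _ _.
pose P : {linear _ -> _} := linear_of (path_map_linear Gam That (h |: alpha) t).
(* Telescoping: the error of the first step carried along the filtered path, plus the error of the
   rest of the path on a homogeneous input. *)
have -> : path_map Gam That (h |: alpha) t u1 - path_map Gam Tn (h |: alpha) t u2 =
    P (u1 - u2) + (P u2 - path_map Gam Tn (h |: alpha) t u2).
  by rewrite linearB addrA subrK.
apply: tsuppD; first by apply: path_hat_ge => //; apply: edge_diff.
by apply: IH => //; apply: edge_n_eq.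
Qed.
End Degrees.

(** * The filtered complex of a ribbon graph *)

Section Chains.
Variables (G : graph) (Gam : ribbon G) (n : nat) (k : comPzRingType) (s : k).
Variable ch : choices G.
Implicit Types (nu : {set vertex G}) (c : chains G k n) (f : mono G n) (i j : int).
Local Notation That := (filtered_structure n s).
Local Notation Tn := (bigraded_structure n s).
Local Notation dhat := (delta_hat Gam n s ch).
Local Notation dn := (delta_n Gam n s ch).
Local Notation deg nu := (state_degree Gam (alpha_of nu)).

Lemma in_supported (P : {set vertex G} -> mono G n -> bool) c :
  c \in supported P <-> forall nu f, c nu f != 0 -> P nu f.
Proof.
split=> [/forallP cP nu f|cP].
  by have /forallP/(_ f)/implyP := cP nu.
by apply/forallP=> nu; apply/forallP=> f; apply/implyP/cP.
Qed.

Lemma delta_neq0 (T : structure k n) c nu f : delta Gam T ch c nu f != 0 ->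
  exists2 v, v \in nu &
    path_map Gam T (alpha_of (nu :\ v)) (steps ch (nu :\ v) v) (c (nu :\ v)) f != 0.
Proof.
rewrite ffunE sum_ffunE => /sum_neq0[v vnu]; rewrite ffunE.
by case/scale_neq0 => _; exists v.
Qed.

(** Supplies a nonzero coefficient of the chain at [nu :\ v], from which the homological degree at
    [nu] is read. *)
Lemma path_map_neq0 (T : structure k n) alpha t (u : tensors G k n) f :
  path_map Gam T alpha t u f != 0 -> exists f0, u f0 != 0.
Proof.
apply: contraPP => u0; have -> : u = 0.
  apply/ffunP=> f0; rewrite [RHS]ffunE; apply/eqP/negPn/negP=> uf0.
  by apply: u0; exists f0.
by rewrite [path_map _ _ _ _ _](linear0 (linear_of (path_map_linear Gam T alpha t))) ffunE eqxx.
Qed.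

Lemma card_chain nu v i : v \in nu -> #|nu :\ v|%:Z = i -> #|nu|%:Z = i + 1.
Proof. by move=> vnu <-; rewrite (cardsD1 v nu) vnu; lia. Qed.

Lemma alpha_ofD1 nu v : v \in nu ->
  [set h in steps ch (nu :\ v) v] :|: alpha_of (nu :\ v) = alpha_of nu.
Proof. by move=> vnu; rewrite alpha_of_steps setD1K. Qed.

Lemma steps_freshD1 nu v : fresh (alpha_of (nu :\ v)) (steps ch (nu :\ v) v).
Proof. by apply: steps_fresh; rewrite !inE eqxx. Qed.

Lemma delta_hat_filt p i c : c \in Cfilt Gam k n p i -> dhat c \in Cfilt Gam k n p (i + 1).
Proof.
move=> /in_supported cF; apply/in_supported=> nu f /delta_neq0[v vnu cf].
have [f0 /cF/andP[/andP[/eqP nui _] _]] := path_map_neq0 cf.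
have cP : tsupp (deg_ge Gam (alpha_of (nu :\ v)) p) (c (nu :\ v)).
  by move=> f1 /cF/andP[/andP[_ fS]]; rewrite /deg_ge /deg_eq fS.
have := path_hat_ge (steps_freshD1 nu v) cP cf.
rewrite /deg_ge alpha_ofD1 // /chain_basis => /andP[-> ->].
by rewrite (card_chain vnu nui) eqxx.
Qed.

Lemma delta_n_graded i j c : c \in Cij Gam k n i j -> dn c \in Cij Gam k n (i + 1) j.
Proof.
move=> /in_supported cF; apply/in_supported=> nu f /delta_neq0[v vnu cf].
have [f0 /cF/andP[/andP[/eqP nui _] _]] := path_map_neq0 cf.
have cP : tsupp (deg_eq Gam (alpha_of (nu :\ v)) j) (c (nu :\ v)).
  by move=> f1 /cF/andP[/andP[_ fS]]; rewrite /deg_ge /deg_eq fS.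
have := path_n_eq (steps_freshD1 nu v) cP cf.
rewrite /deg_eq alpha_ofD1 // /chain_basis => /andP[-> ->].
by rewrite (card_chain vnu nui) eqxx.
Qed.

Lemma delta_diff i j c : c \in Cij Gam k n i j ->
  dhat c - dn c \in Cfilt Gam k n (j + 1) (i + 1).
Proof.
move=> /in_supported cF; apply/in_supported=> nu f cf.
have {cf} : (dhat c nu - dn c nu) f != 0 by move: cf; rewrite !ffunE.
rewrite [dhat c nu]deltaE [dn c nu]deltaE -sumrB sum_ffunE => /sum_neq0[v vnu].
rewrite -scalerBr ffunE => /scale_neq0[_ cf].
have [f0 c0] : exists f0, c (nu :\ v) f0 != 0.
  apply: contrapT => nc.
  have n0 (T : structure k n) :
      path_map Gam T (alpha_of (nu :\ v)) (steps ch (nu :\ v) v) (c (nu :\ v)) f = 0.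
    by apply/eqP/negPn/negP=> /path_map_neq0.
  by move: cf; rewrite !ffunE !n0 subrr eqxx.
have /andP[/andP[/eqP nui _] _] := cF _ _ c0.
have cP : tsupp (deg_eq Gam (alpha_of (nu :\ v)) j) (c (nu :\ v)).
  by move=> f1 /cF/andP[/andP[_ fS]]; rewrite /deg_ge /deg_eq fS.
have := path_diff (steps_freshD1 nu v) cP cf.
rewrite /deg_ge alpha_ofD1 // /chain_basis => /andP[-> ->].
by rewrite (card_chain vnu nui) eqxx.
Qed.

Lemma Cfilt_decr p i c : c \in Cfilt Gam k n (p + 1) i -> c \in Cfilt Gam k n p i.
Proof.
move=> /in_supported cF; apply/in_supported=> nu f /cF/andP[-> /=]; lia.
Qed.

Lemma Cfilt_sub p i c : c \in Cfilt Gam k n p i -> c \in Chat Gam k n i.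
Proof.
by move=> /in_supported cF; apply/in_supported=> nu f /cF/andP[].
Qed.

Lemma Cij_sub i j c : c \in Cij Gam k n i j -> c \in Cfilt Gam k n j i.
Proof.
by move=> /in_supported cF; apply/in_supported=> nu f /cF/andP[-> /eqP->] /=.
Qed.

Lemma Cij_cap i j c : c \in Cij Gam k n i j -> c \in Cfilt Gam k n (j + 1) i -> c = 0.
Proof.
move=> /in_supported cj /in_supported cF; apply/ffunP=> nu; apply/ffunP=> f.
rewrite !ffunE; apply/eqP/negPn/negP=> c0.
by have /andP[_ /eqP d1] := cj _ _ c0; have /andP[_] := cF _ _ c0; lia.
Qed.

Lemma Cfilt_split i j c : c \in Cfilt Gam k n j i ->
  exists2 c0, c0 \in Cij Gam k n i j & c - c0 \in Cfilt Gam k n (j + 1) i.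
Proof.
move=> /in_supported cF.
exists [ffun nu : {set vertex G} => [ffun f => if deg nu f == j then c nu f else 0]].
  apply/in_supported=> nu f; rewrite !ffunE; case: ifP => [dj /cF/andP[-> _]|_].
    by [].
  by rewrite eqxx.
apply/in_supported=> nu f; rewrite !ffunE; have [_|/eqP ne] := eqVneq (deg nu f) j.
  by rewrite subrr eqxx.
by rewrite subr0 => /cF/andP[-> /=]; lia.
Qed.

(** A crude bound, but common to all states and monomials, so that the filtrations of all
    homological degrees start and end at the same places. *)
Definition degree_bound : nat := \sum_(nu : {set vertex G}) \sum_(f : mono G n) `|deg nu f|%N.

Lemma deg_bound nu f : (`|deg nu f| <= degree_bound)%N.
Proof.
rewrite /degree_bound (bigD1 nu) //= (bigD1 f) //=.
by rewrite -addnA leq_addr.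
Qed.

Lemma Cfilt_full p i c : p <= - degree_bound%:Z -> c \in Chat Gam k n i ->
  c \in Cfilt Gam k n p i.
Proof.
move=> pB /in_supported cF; apply/in_supported=> nu f /cF ->.
by have := deg_bound nu f; lia.
Qed.

Lemma Cfilt_zero p i c : degree_bound%:Z + 1 <= p -> c \in Cfilt Gam k n p i -> c = 0.
Proof.
move=> pB /in_supported cF; apply/ffunP=> nu; apply/ffunP=> f.
rewrite !ffunE; apply/eqP/negPn/negP=> /cF/andP[_].
by have := deg_bound nu f; lia.
Qed.
End Chains.

(** Over a general ring the limit page determines the filtered homology only up to extensions. Its
    identification with the homology itself is therefore stated as a direct sum when the graded
    pieces are projective, and in particular over a field. *)
Theorem theorem6p6 (G : graph) (Gam : ribbon G) (n : nat)
    (k : comPzRingType) (sqrtn : k) (ch : choices G) :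
  connected G -> trivalent G -> (0 < n)%N -> sqrtn ^+ 2 = n%:R ->
  exists E : spectral_sequence k,
    [/\ induced_by_filtration (delta_hat Gam n sqrtn ch) (Cfilt Gam k n) E,
        forall i j, lmod_iso (page E 1 i j) (VCH Gam n sqrtn ch i j)
      & exists Einf : int -> int -> lmodType k,
        [/\ is_infinity_page E Einf,
            abuts Einf (VCHhat_filtration Gam n sqrtn ch),
            forall i, (forall j, projective (Einf i j)) ->
              isom_direct_sum (Einf i) (VCHhat Gam n sqrtn ch i)
          & is_field k -> forall i,
              isom_direct_sum (Einf i) (VCHhat Gam n sqrtn ch i)]].
Proof.
move=> _ _ n_gt0 s2.
have dd c : delta_hat Gam n sqrtn ch (delta_hat Gam n sqrtn ch c) = 0.
  exact: delta_sqr.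
have F_decr := @Cfilt_decr G Gam n k.
have F_d := @delta_hat_filt G Gam n k sqrtn ch.
have F_sub := @Cfilt_sub G Gam n k.
pose B := (degree_bound Gam n)%:Z.
have F_full : forall p i c, p <= - B -> c \in Chat Gam k n i -> c \in Cfilt Gam k n p i.
  exact: Cfilt_full.
have F_zero : forall p i c, B + 1 <= p -> c \in Cfilt Gam k n p i -> c = 0.
  exact: Cfilt_zero.
exists (filtered_ss F_decr dd); split=> [|i j|].
- exact: filtered_ss_induced.
- apply: homology_ss_page1 => //.
  + exact: Cij_sub.
  + exact: Cfilt_split.
  + exact: Cij_cap.
  + exact: delta_n_graded.
  + exact: delta_diff.
have split_H i : (forall j, projective (ss_limit (delta_hat Gam n sqrtn ch) (Cfilt Gam k n) (Chat Gam k n) i j)) ->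
    isom_direct_sum (ss_limit (delta_hat Gam n sqrtn ch) (Cfilt Gam k n) (Chat Gam k n) i)
      (VCHhat Gam n sqrtn ch i).
  apply: (split_filtration (p0 := - B) (p1 := B + 1)).
  - by move=> p; apply: (Fil_decr F_decr).
  - by move=> p h; apply: (Fil_full F_full).
  - by move=> p h; apply: (Fil_zero F_zero).
exists (ss_limit (delta_hat Gam n sqrtn ch) (Cfilt Gam k n) (Chat Gam k n)); split.
- exact: (filtered_ss_limit _ _ F_sub F_full F_zero).
- split=> [i p|i|i|i j].
  + exact: (Fil_decr F_decr).
  + by exists (- B) => h; apply: (Fil_full F_full).
  + by exists (B + 1) => h; apply: (Fil_zero F_zero).
  + by exists idfun; exists idfun.
- exact: split_H.
- by move=> k_field i; apply: split_H => j; apply: field_projective.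
Qed.
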